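(* Let $\varepsilon\in(0,\varepsilon_0)$. There exists a universal constant $C>0$ such that $$\mathcal L^+_{\mathcal X_n,\Lambda,\tau,\varepsilon}u(T_\varepsilon(x))\le \mathcal L^+_{\Omega,\Lambda+\varepsilon^2,\tau+2\varepsilon,\varepsilon}[u\circ T_\varepsilon](x)+C\|u\|_{L^\infty(\mathcal X_n)}$$ for every $x\in\Omega_{-\varepsilon}$ and each $u\in L^\infty(\mathcal X_n)$, with probability at least $$1-2n\exp\{-c_0\,n\,\varepsilon^{3N+4}\},$$ where $c_0=c_0(\operatorname{diam}\Omega)>0$.
   Context: $\Omega\subset\mathbb R^N$ is an open bounded domain and $\mu$ is a probability measure supported in $\Omega$ with Lipschitz density $\phi:\Omega\to[\phi_0,\phi_1]$, $0<\phi_0\le\phi_1<\infty$, extended by $\phi\equiv0$ to $\mathbb R^N\setminus\Omega$. $\mathcal X_n=\{Z_1,\dots,Z_n\}\subset\Omega$ is a random data cloud: the $Z_i$ are i.i.d. random points with law $\mu$. It is assumed that there is $c>0$ such that for every $\delta>0$ there is a partition $B_1,\dots,B_M$ of $\Omega$ with $B_i\subset B_\delta(x_i)$ for some $x_i\in B_i$ and $|B_i|\ge c\delta^N$. A partition of $\Omega$ is a pairwise disjoint finite family of sets of positive measure with union $\Omega$. Transport map: $T_\varepsilon:\Omega\to\mathcal X_n$ is defined by $T_\varepsilon(x)=Z_i$ if and only if $x\in\mathcal U_i$, where $\mathcal U_1,\dots,\mathcal U_n$ is a partition of $\Omega$ for which there is a probability density $\phi_\varepsilon\in L^\infty(\Omega)$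 with $$Z_i\in\mathcal U_i\subset B_{\varepsilon^3}(Z_i),\qquad\int_{\mathcal U_i}\phi_\varepsilon\,dy=\frac1n,\qquad\|\phi_\varepsilon-\phi\|_\infty\le C_0\varepsilon^2,$$ $C_0>0$ being a universal constant. The probability in the claim is that of the event that such a partition and density exist; on this event the stated inequality holds. $\Omega_{-\varepsilon}=\{x\in\Omega:\mathrm{dist}(x,\mathbb R^N\setminus\Omega)>\varepsilon\}$ and $B_r^{\mathcal X_n}(x)=\mathcal X_n\cap B_r(x)$. Fix $\Lambda,\tau\ge1$ and $\beta=1-\alpha\in(0,1]$. For $u\in L^\infty(\mathcal X_n)$, $$\mathcal L_{\mathcal X_n,\Lambda,\tau,\varepsilon}^+u(Z_i)=\frac1{\varepsilon^2}\Big[\alpha\max_{Z_j\in B^{\mathcal X_n}_{\Lambda\varepsilon}(Z_i)}\ \max_{Z_k\in B^{\mathcal X_n}_{\tau\varepsilon^2}(2Z_i-Z_j)}\frac{u(Z_j)+u(Z_k)}2+\frac{\beta}{\mathrm{card}(B^{\mathcal X_n}_\varepsilon(Z_i))}\sum_{Z_j\in B^{\mathcal X_n}_\varepsilon(Z_i)}u(Z_j)-u(Z_i)\Big].$$ For $\Lambda',\tau'\ge1$, $v\in L^\infty(\Omega)$ and $x\in\Omega$, $$\mathcal L^+_{\Omega,\Lambda',\tau',\varepsilon}v(x)=\frac1{\varepsilon^2}\Big[\alpha\sup_{|z|<\Lambda'\varepsilon}\ \sup_{|h|<\tau'\varepsilon^2}\frac{v(x+z)+v(x-z+h)}2+\frac{\beta}{\mu(B_\varepsilon(x))}\int_{B_\varepsilon(x)}v\,d\mu-v(x)\Big].$$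 A constant is called universal if it depends only on $N,\beta,\Lambda,\tau,\phi_0,\phi_1$ and the Lipschitz constant of $\phi$; additional dependencies are listed in parentheses. $\varepsilon_0\in(0,\tfrac12)$ is a fixed, sufficiently small universal constant, and $\Omega_{-\varepsilon_0}\ne\emptyset$ is assumed.
   Formalization: The partition assumption is required only for 0<δ<1 (for every δ>0 it cannot hold, as |B_i|≤|Ω|), and c_0 may depend, besides diam Ω and the universal quantities, on the constant c of that assumption; otherwise the bound fails, e.g. for a ball with a thin tentacle. *)

(* Defs.v *)
From HB Require Import structures.
From mathcomp Require Import all_boot all_order all_algebra.
From mathcomp Require Import all_classical all_reals all_analysis.

Set Implicit Arguments.
Unset Strict Implicit.
Unset Printing Implicit Defensive.

Import Order.TTheory GRing.Theory Num.Theory.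
Import numFieldNormedType.Exports.

Local Open Scope classical_set_scope.
Local Open Scope ring_scope.

Definition rV_display : measure_display.
Proof. exact: default_measure_display. Qed.

(* 'rV[R]_N carries the product sigma-algebra (generated by the coordinates),
   which is the Borel sigma-algebra of R^N. *)
Section rV_measurable.
Variables (R : realType) (N : nat).

Let coord (i : 'I_N) (x : 'rV[R]_N) : R := x ord0 i.

Let rV_set0 : g_sigma_preimage coord set0.
Proof. exact: sigma_algebra0. Qed.

Let rV_setC A : g_sigma_preimage coord A -> g_sigma_preimage coord (~` A).
Proof. exact: sigma_algebraC. Qed.

Let rV_bigcup (F : (set 'rV[R]_N)^nat) :
  (forall i, g_sigma_preimage coord (F i)) ->
  g_sigma_preimage coord (\bigcup_i (F i)).
Proof. exact: sigma_algebra_bigcup. Qed.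

HB.instance Definition _ := @isMeasurable.Build rV_display
  'rV[R]_N (g_sigma_preimage coord) rV_set0 rV_setC rV_bigcup.

End rV_measurable.

Lemma measurable_coord (R : realType) (N : nat) (i : 'I_N) :
  measurable_fun [set: 'rV[R]_N] (fun x => x ord0 i).
Proof.
move=> _ Y mY; rewrite setTI; apply: sub_sigma_algebra => /=.
rewrite -bigcup_seq/=; exists i => /=; first by rewrite mem_index_enum.
by exists Y => //; rewrite setTI.
Qed.

Lemma measurable_fun_rV d (T : measurableType d) (R : realType) (N : nat)
    (f : T -> 'rV[R]_N) :
  (forall i, measurable_fun [set: T] (fun t => f t ord0 i)) ->
  measurable_fun [set: T] f.
Proof.
move=> mf _ Y; rewrite setTI; move: Y.
have sF : sigma_algebra setT [set Y | measurable (f @^-1` Y)].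
  split => /=.
  - by rewrite preimage_set0.
  - by move=> A mA; rewrite setTD preimage_setC; exact: measurableC.
  - by move=> A mA; rewrite preimage_bigcup; exact: bigcup_measurable.
apply: smallest_sub => // Y; rewrite -bigcup_seq => -[i _] [B mB <-] /=.
by rewrite setTI -[X in measurable X]setTI; exact: mf.
Qed.

Section lebesgue_cons.
Variables (R : realType) (N : nat).
Variable m : {sigma_finite_measure set 'rV[R]_N -> \bar R}.

Definition rV_cons (p : R * 'rV[R]_N) : 'rV[R]_N.+1 := row_mx p.1%:M p.2.

Lemma rV_cons0 p : rV_cons p ord0 ord0 = p.1.
Proof.
have -> : (ord0 : 'I_N.+1) = lshift N (ord0 : 'I_1) by exact/val_inj.
by rewrite /rV_cons (@row_mxEl _ 1 1 N) mxE eqxx mulr1n.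
Qed.

Lemma rV_consS p i : rV_cons p ord0 (lift ord0 i) = p.2 ord0 i.
Proof.
have -> : lift ord0 i = rshift 1 i by exact/val_inj.
by rewrite /rV_cons (@row_mxEr _ 1 1 N).
Qed.

Lemma measurable_rV_cons :
  measurable_fun [set: measurableTypeR R * 'rV[R]_N] rV_cons.
Proof.
apply: measurable_fun_rV => i; case: (unliftP ord0 i) => [j ->|->].
  under eq_fun do rewrite rV_consS.
  apply: (measurableT_comp (measurable_coord j)).
  exact: measurable_snd.
under eq_fun do rewrite rV_cons0.
exact: measurable_fst.
Qed.

Definition lebesgue_cons : set 'rV[R]_N.+1 -> \bar R :=
  pushforward (@lebesgue_measure R \x m)%E rV_cons.

Let lebesgue_cons0 : lebesgue_cons set0 = 0%E.
Proof. by rewrite /lebesgue_cons /pushforward preimage_set0 measure0. Qed.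

Let lebesgue_cons_ge0 A : (0 <= lebesgue_cons A)%E.
Proof. by rewrite /lebesgue_cons /pushforward measure_ge0. Qed.

Let lebesgue_cons_sigma_additive : semi_sigma_additive lebesgue_cons.
Proof.
move=> F mF tF mUF; rewrite /lebesgue_cons /pushforward preimage_bigcup.
apply: measure_semi_sigma_additive.
- by move=> n; rewrite -[X in measurable X]setTI; exact: measurable_rV_cons.
- apply/trivIsetP => /= i j _ _ ij; rewrite -preimage_setI.
  by move/trivIsetP : tF => /(_ _ _ _ _ ij) ->//; rewrite preimage_set0.
- rewrite -preimage_bigcup -[X in measurable X]setTI.
  exact: measurable_rV_cons.
Qed.

HB.instance Definition _ := isMeasure.Build _ _ _ lebesgue_cons
  lebesgue_cons0 lebesgue_cons_ge0 lebesgue_cons_sigma_additive.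

Let lebesgue_cons_sigma_finite : sigma_finite setT lebesgue_cons.
Proof.
have /sigma_finiteP[F [TF ndF Foo]] := sigma_finiteT (@lebesgue_measure R).
have /sigma_finiteP[G [TG ndG Goo]] := sigma_finiteT m.
pose g (x : 'rV[R]_N.+1) : measurableTypeR R * 'rV[R]_N :=
  (x ord0 ord0, \row_i x ord0 (lift ord0 i)).
have gK p : g (rV_cons p) = p.
  case: p => r v; rewrite /g rV_cons0; congr pair.
  by apply/rowP => i; rewrite mxE rV_consS.
have mg : measurable_fun setT g.
  apply: measurable_fun_pair; first exact: measurable_coord.
  apply: measurable_fun_rV => i.
  under eq_fun do rewrite mxE.
  exact: measurable_coord.
exists (fun n => g @^-1` (F n `*` G n)).
  apply/esym; rewrite -subTset => x _.
  have [k _ Fk] : (\bigcup_i F i) (g x).1 by rewrite -TF.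
  have [l _ Gl] : (\bigcup_i G i) (g x).2 by rewrite -TG.
  exists (maxn k l) => //; split.
  - by move: Fk; exact/subsetPset/ndF/leq_maxl.
  - by move: Gl; exact/subsetPset/ndG/leq_maxr.
move=> n; have [mF Fn] := Foo n; have [mG Gn] := Goo n; split.
  by rewrite -[X in measurable X]setTI; apply: mg => //; exact: measurableX.
rewrite /lebesgue_cons /pushforward (_ : _ @^-1` _ = F n `*` G n).
  by rewrite product_measure1E// lte_mul_pinfty// ge0_fin_numE.
by rewrite -comp_preimage (_ : g \o rV_cons = id)//; exact/funext.
Qed.

HB.instance Definition _ := Measure_isSigmaFinite.Build _ _ _ lebesgue_cons
  lebesgue_cons_sigma_finite.

End lebesgue_cons.

(* N-dimensional Lebesgue measure on Borel sets; see lebesgue_rV_box. *)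
Fixpoint lebesgue_rV (R : realType) (N : nat) :
    {sigma_finite_measure set 'rV[R]_N -> \bar R} :=
  match N with
  | 0 => [the {sigma_finite_measure set 'rV[R]_0 -> \bar R} of
            dirac (0 : 'rV[R]_0)]
  | N'.+1 => [the {sigma_finite_measure set 'rV[R]_N'.+1 -> \bar R} of
            lebesgue_cons (lebesgue_rV R N')]
  end.

Lemma lebesgue_rV_box (R : realType) (N : nat)
    (A : 'I_N -> set (measurableTypeR R)) :
  (forall i, measurable (A i)) ->
  lebesgue_rV R N [set x | forall i, A i (x ord0 i)] =
  (\prod_(i < N) lebesgue_measure (A i))%E.
Proof.
elim: N A => [|N IH] A mA /=.
  by rewrite big_ord0 diracE mem_set// => -[].
rewrite big_ord_recl -IH; last by move=> i; exact: mA.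
rewrite /lebesgue_cons /pushforward.
have mB : measurable ([set x | forall i, A (lift ord0 i) (x ord0 i)] :
    set 'rV[R]_N).
  rewrite [X in measurable X](_ : _ = \big[setI/setT]_(i < N)
      ((fun x : 'rV[R]_N => x ord0 i) @^-1` A (lift ord0 i))).
    apply: bigsetI_measurable => i _; rewrite -[X in measurable X]setTI.
    exact: (measurable_coord i measurableT (mA _)).
  apply/seteqP; split => x /=; rewrite -bigcap_seq /= => H i; first by move=> _.
  by apply: H; rewrite /= mem_index_enum.
rewrite -product_measure1E//; congr (_ _); apply/seteqP; split => p /=.
  by move=> H; split=> [|i]; rewrite -?(rV_cons0 p) -?(rV_consS p); exact: H.
move=> [H0 HS] i; case: (unliftP ord0 i) => [j ->|->].
  by rewrite rV_consS; exact: HS.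
by rewrite rV_cons0.
Qed.

Section euclidean.
Variables (R : realType) (N : nat).
Implicit Types (x y : 'rV[R]_N) (A Omega : set 'rV[R]_N).

(* The library norm on 'rV[R]_N is the sup norm. *)
Definition enorm x : R := Num.sqrt (\sum_(i < N) x ord0 i ^+ 2).

Definition eball x (r : R) : set 'rV[R]_N := [set y | enorm (y - x) < r].

Definition edist x A : R := inf [set enorm (x - y) | y in A].

Definition ediam A : R := sup [set enorm (p.1 - p.2) | p in A `*` A].

Definition bounded_domain Omega : Prop :=
  [/\ open Omega, connected Omega, Omega !=set0 &
      exists r, Omega `<=` eball 0 r].

Definition inner_domain Omega (r : R) : set 'rV[R]_N :=
  [set x | Omega x /\ r < edist x (~` Omega)].

Definition is_partition Omega (M : nat) (B : 'I_M -> set 'rV[R]_N) : Prop :=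
  [/\ forall i, measurable (B i),
      forall i, (0 < lebesgue_rV R N (B i))%E,
      trivIset setT B &
      \bigcup_i B i = Omega].

(* The range of delta must be bounded: for large delta the inequality
   c * delta ^+ N <= |B_i| <= |Omega| cannot hold.  Any other upper bound on
   delta gives the same condition up to a change of c. *)
Definition partition_condition Omega (c : R) : Prop :=
  forall delta : R, 0 < delta < 1 ->
  exists (M : nat) (B : 'I_M -> set 'rV[R]_N) (x : 'I_M -> 'rV[R]_N),
    is_partition Omega B /\
    forall i, [/\ B i (x i), B i `<=` eball (x i) delta &
                 ((c * delta ^+ N)%:E <= lebesgue_rV R N (B i))%E].

Definition has_lipschitz_density Omega (phi0 phi1 L : R)
    (mu : probability 'rV[R]_N R) (phi : 'rV[R]_N -> R) : Prop :=
  [/\ forall x, Omega x -> phi0 <= phi x <= phi1,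
      forall x y, Omega x -> Omega y ->
        `|phi x - phi y| <= L * enorm (x - y),
      forall x, ~ Omega x -> phi x = 0 &
      forall A, measurable A ->
        mu A = (\int[lebesgue_rV R N]_(x in A) (phi x)%:E)%E].

Definition Linfty_norm Omega (f : 'rV[R]_N -> R) : \bar R :=
  'N[lebesgue_rV R N]_+oo[EFin \o (f \_ Omega)]%E.

Definition is_Linfty_density Omega (f : 'rV[R]_N -> R) : Prop :=
  [/\ measurable_fun Omega f,
      forall x, Omega x -> 0 <= f x,
      (Linfty_norm Omega f < +oo)%E &
      (\int[lebesgue_rV R N]_(x in Omega) (f x)%:E = 1)%E].

End euclidean.

Section sample.
Variables (R : realType) (N : nat) (d : measure_display).
Variables (S : measurableType d) (P : probability S R).

Definition iid_sample (mu : probability 'rV[R]_N R) (n : nat)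
    (Z : 'I_n -> S -> 'rV[R]_N) : Prop :=
  [/\ forall i, measurable_fun setT (Z i),
      forall i A, measurable A -> P (Z i @^-1` A) = mu A &
      forall A : 'I_n -> set 'rV[R]_N, (forall i, measurable (A i)) ->
        P (\bigcap_i (Z i @^-1` A i)) = (\prod_(i < n) P (Z i @^-1` A i))%E].

End sample.

Section cloud.
Variables (R : realType) (N n : nat) (Z : 'I_n -> 'rV[R]_N).
Implicit Types (Omega : set 'rV[R]_N) (U : 'I_n -> set 'rV[R]_N).

Definition transport_partition Omega (phi : 'rV[R]_N -> R) (C0 eps : R) U
    (phi_eps : 'rV[R]_N -> R) : Prop :=
  [/\ is_partition Omega U,
      forall i, U i (Z i) /\ U i `<=` eball (Z i) (eps ^+ 3),
      is_Linfty_density Omega phi_eps,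
      forall i,
        (\int[lebesgue_rV R N]_(y in U i) (phi_eps y)%:E = (n%:R^-1)%:E)%E &
      (Linfty_norm Omega (phi_eps \- phi)%R <= (C0 * eps ^+ 2)%:E)%E].

(* T is unconstrained outside Omega. *)
Definition transport_map Omega U (T : 'rV[R]_N -> 'rV[R]_N) : Prop :=
  forall i x, Omega x -> (T x = Z i <-> U i x).

Definition cloud : seq 'rV[R]_N := undup (codom Z).

Definition cloud_ball (x : 'rV[R]_N) (r : R) : seq 'rV[R]_N :=
  [seq y <- cloud | enorm (y - x) < r].

(* A function on the cloud is represented by a function on 'rV[R]_N of which
   only the values on the cloud are used. *)
Implicit Types u : 'rV[R]_N -> R.

Definition cloud_norm u : R := \big[Num.max/0]_(y <- cloud) `|u y|.

(* For x in the cloud (and positive radii) the set below is finite and contains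
   u x, so that its sup is a max; a point y for which no y' is available does
   not contribute. *)
Definition cloud_max u (Lambda tau eps : R) (x : 'rV[R]_N) : R :=
  sup [set w | exists y y',
    [/\ y \in cloud_ball x (Lambda * eps),
        y' \in cloud_ball (2 *: x - y) (tau * eps ^+ 2) &
        w = (u y + u y') / 2]].

Definition L_cloud (beta Lambda tau eps : R) u (x : 'rV[R]_N) : R :=
  (eps ^+ 2)^-1 *
  ((1 - beta) * cloud_max u Lambda tau eps x +
   beta / (size (cloud_ball x eps))%:R * (\sum_(y <- cloud_ball x eps) u y) -
   u x).

End cloud.

Section domain_operator.
Variables (R : realType) (N : nat).
Variables (Omega : set 'rV[R]_N) (mu : probability 'rV[R]_N R).

(* v is a function on Omega, so only z and h with x + z and x - z + h in Omega
   are taken into account. *)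
Definition domain_sup (v : 'rV[R]_N -> R) (Lambda tau eps : R)
    (x : 'rV[R]_N) : R :=
  sup [set w | exists z h,
    [/\ enorm z < Lambda * eps /\ Omega (x + z),
        enorm h < tau * eps ^+ 2 /\ Omega (x - z + h) &
        w = (v (x + z) + v (x - z + h)) / 2]].

Definition L_domain (beta Lambda tau eps : R) (v : 'rV[R]_N -> R)
    (x : 'rV[R]_N) : R :=
  (eps ^+ 2)^-1 *
  ((1 - beta) * domain_sup v Lambda tau eps x +
   beta / fine (mu (eball x eps)) *
     (\int[mu]_(y in eball x eps `&` Omega) v y) -
   v x).

End domain_operator.

(* Main.v *)
Require Import Defs.
From mathcomp Require Import all_boot all_order all_algebra.
From mathcomp Require Import all_classical all_reals all_analysis.
From mathcomp Require Import measurable_realfun ess_sup_inf ring lra.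

Set Implicit Arguments.
Unset Strict Implicit.
Unset Printing Implicit Defensive.

Import Order.TTheory GRing.Theory Num.Theory.
Import numFieldNormedType.Exports.

Local Open Scope classical_set_scope.
Local Open Scope ring_scope.

(** For the probability estimate, cut Omega into cells of diameter less than
    eps^3, each of mass at least a constant times eps^(3N).  By a Chernoff bound
    and a union bound, the number of sample points in every cell is n times its
    mass up to a relative error eps^2; when there are more cells than points the
    claimed bound is negative.  Since the Z_i are almost surely distinct, each
    cell can then be split into pieces of equal mass, one for each of its points,
    and phi_eps is phi rescaled by the relative error on each cell.

    For the inequality, T moves points by less than eps^3, so every pair
    competing in the maximum over the cloud competes in the supremum over the
    domain with the enlarged radii.  The two averages give the cell of Z_j the
    weights 1/n (if Z_j lies in the ball) and mu of the part of the cell in the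
    ball.  These differ by O(eps^2) times the volume of the cell, except for the
    cells meeting the annulus between the radii eps - 2 eps^3 and eps + 2 eps^3
    around x, whose volume is O(eps^2) relative to that of the ball. *)

(** * The Euclidean norm on row vectors *)

Section euclidean_norm.
Variables (R : realType) (N : nat).
Implicit Types x y : 'rV[R]_N.

Lemma enorm_ge0 x : 0 <= enorm x.
Proof. exact: sqrtr_ge0. Qed.

Lemma enorm_sqr x : enorm x ^+ 2 = \sum_(i < N) x ord0 i ^+ 2.
Proof. by rewrite sqr_sqrtr// sumr_ge0// => i _; exact: sqr_ge0. Qed.

Lemma enorm0 : enorm (0 : 'rV[R]_N) = 0.
Proof.
by rewrite /enorm big1 ?sqrtr0// => i _; rewrite mxE expr0n.
Qed.

Lemma enormN x : enorm (- x) = enorm x.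
Proof.
by congr Num.sqrt; apply: eq_bigr => i _; rewrite mxE sqrrN.
Qed.

Lemma enormB x y : enorm (x - y) = enorm (y - x).
Proof. by rewrite -enormN opprB. Qed.

Lemma enormZ (a : R) x : 0 <= a -> enorm (a *: x) = a * enorm x.
Proof.
move=> a0; rewrite /enorm -[a in RHS]ger0_norm// -sqrtr_sqr -sqrtrM ?sqr_ge0//.
by rewrite mulr_sumr; congr Num.sqrt; apply: eq_bigr => i _; rewrite mxE exprMn.
Qed.

Lemma ler_coord_enorm x i : `|x ord0 i| <= enorm x.
Proof.
rewrite -sqrtr_sqr ler_wsqrtr// (bigD1 i)//= lerDl.
by rewrite sumr_ge0// => j _; exact: sqr_ge0.
Qed.

Lemma enorm_eq0 x : enorm x = 0 -> x = 0.
Proof.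
move=> x0; apply/rowP => i; apply/eqP; rewrite mxE -normr_le0 -x0.
exact: ler_coord_enorm.
Qed.

(** Sum the squares of [enorm y * x_i - enorm x * y_i], which are nonnegative, and divide by
    [2 * (enorm x * enorm y)]; the case of a zero norm is therefore set apart. *)
Lemma cauchy_schwarz x y :
  \sum_(i < N) x ord0 i * y ord0 i <= enorm x * enorm y.
Proof.
have [x0|x0] := eqVneq (enorm x) 0.
  rewrite x0 mul0r big1// => i _; by rewrite (enorm_eq0 x0) mxE mul0r.
have [y0|y0] := eqVneq (enorm y) 0.
  rewrite y0 mulr0 big1// => i _; by rewrite (enorm_eq0 y0) mxE mulr0.
have a0 : 0 < enorm x by rewrite lt_def x0 enorm_ge0.
have b0 : 0 < enorm y by rewrite lt_def y0 enorm_ge0.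
rewrite -(ler_pM2l (_ : 0 < 2 * (enorm x * enorm y))); last first.
  by rewrite !mulr_gt0.
have -> : 2 * (enorm x * enorm y) * (enorm x * enorm y) =
    enorm y ^+ 2 * enorm x ^+ 2 + enorm x ^+ 2 * enorm y ^+ 2 by ring.
rewrite [X in _ * X + _]enorm_sqr [X in _ + _ * X]enorm_sqr !mulr_sumr -big_split/=.
apply: ler_sum => i _; rewrite -subr_ge0.
rewrite [leRHS](_ : _ = (enorm y * x ord0 i - enorm x * y ord0 i) ^+ 2); last by ring.
exact: sqr_ge0.
Qed.

Lemma ler_enormD x y : enorm (x + y) <= enorm x + enorm y.
Proof.
rewrite -(@ler_pXn2r _ 2)// ?nnegrE ?addr_ge0 ?enorm_ge0// sqrrD !enorm_sqr.
under eq_bigr do rewrite mxE sqrrD.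
rewrite !big_split/= lerD2r lerD2l -big_split/= mulr2n.
by rewrite big_split/= lerD// cauchy_schwarz.
Qed.

Lemma enorm_le_sum x : enorm x <= \sum_(i < N) `|x ord0 i|.
Proof.
rewrite -(@ler_pXn2r _ 2)// ?nnegrE ?enorm_ge0 ?sumr_ge0//.
rewrite enorm_sqr expr2 mulr_suml ler_sum// => i _.
rewrite -real_normK ?num_real// expr2 ler_wpM2l//.
by rewrite (bigD1 i)//= lerDl sumr_ge0.
Qed.

Lemma ler_enorm_dist x y z : enorm (x - z) <= enorm (x - y) + enorm (y - z).
Proof. by rewrite (le_trans _ (ler_enormD _ _))// addrA subrK. Qed.

End euclidean_norm.

(** * Borel sets and measurability of Lipschitz functions *)

Section rV_borel.
Variables (R : realType) (N : nat).
Implicit Types (x y : 'rV[R]_N) (A Omega : set 'rV[R]_N).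

Lemma measurable_box (B : 'I_N -> set (measurableTypeR R)) :
  (forall i, measurable (B i)) ->
  measurable [set x : 'rV[R]_N | forall i, B i (x ord0 i)].
Proof.
move=> mB; rewrite [X in measurable X](_ : _ = \big[setI/setT]_(i < N)
    ((fun x : 'rV[R]_N => x ord0 i) @^-1` B i)).
  apply: bigsetI_measurable => i _; rewrite -[X in measurable X]setTI.
  exact: (measurable_coord i measurableT (mB _)).
apply/seteqP; split => x /=; rewrite -bigcap_seq /= => H i; first by move=> _.
by apply: H; rewrite /= mem_index_enum.
Qed.

(** Openness in the sup norm, spelled out in coordinates so that it can be checked by hand for
    superlevel sets as well. *)
Definition coord_open A := forall x, A x -> exists2 e : R, 0 < e &
  forall y, (forall i, `|x ord0 i - y ord0 i| < e) -> A y.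

Lemma open_coord_open A : open A -> coord_open A.
Proof.
rewrite openE => oA x /oA /nbhs_ballP[e /= e0 xeA]; exists e => // y xy.
by apply: xeA; split=> // i j; rewrite ord1; exact: xy.
Qed.

(** [A] is the union of the countably many boxes with rational centre and half-side [1/(m+1)] that
    it contains; [F] replaces the other boxes by the empty set. Two points of a box differ by less
    than [2/(m+1)] in each coordinate, so every point of [A] has a box small enough to stay in
    [A]. *)
Lemma coord_open_measurable A : coord_open A -> measurable A.
Proof.
move=> oA.
pose box (p : 'rV[rat]_N * nat) : set 'rV[R]_N :=
  [set y | forall i, `]ratr (p.1 ord0 i) - p.2.+1%:R^-1,
                      ratr (p.1 ord0 i) + p.2.+1%:R^-1[%classic (y ord0 i)].
pose F p := if pselect (box p `<=` A) is left _ then box p else set0.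
rewrite (_ : A = \bigcup_p F p).
  apply: countable_bigcupT_measurable => //.
  move=> p; rewrite /F; case: pselect => // _.
  apply: (@measurable_box (fun i => `]ratr (p.1 ord0 i) - p.2.+1%:R^-1,
      ratr (p.1 ord0 i) + p.2.+1%:R^-1[%classic)) => i.
  exact: measurable_itv.
apply/seteqP; split => [x Ax|x [p _]]; last first.
  by rewrite /F; case: pselect => // pA /pA.
have [e e0 xA] := oA x Ax.
have [m me] : exists m : nat, m.+1%:R^-1 < e / 2.
  have [m hm] := ltr_add_invr (divr_gt0 e0 (ltr0Sn R 1)).
  by exists m; rewrite add0r in hm.
have m0 : 0 < m.+1%:R^-1 :> R by rewrite invr_gt0.
have /choice[q qP] : forall i : 'I_N, exists q : rat,
    x ord0 i - m.+1%:R^-1 < ratr q < x ord0 i + m.+1%:R^-1.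
  move=> i; have [|q] := @rat_in_itvoo R (x ord0 i - m.+1%:R^-1) (x ord0 i + m.+1%:R^-1).
    by rewrite ltrBlDr -addrA ltrDl addr_gt0.
  by rewrite in_itv/=; exists q.
exists (\row_i q i, m) => //.
have xbox : box (\row_i q i, m) x.
  by move=> i /=; rewrite mxE in_itv/=; have := qP i;
    move: (m.+1%:R^-1 : R) => t /andP[q1 q2]; apply/andP; split; lra.
rewrite /F; case: pselect => // boxA; exfalso; apply: boxA => y ybox.
apply: xA => i; have := ybox i; have := xbox i.
rewrite /= !in_itv/= ltr_distl mxE.
move: me; move: (m.+1%:R^-1 : R) => t te /andP[x1 x2] /andP[y1 y2].
by apply/andP; split; lra.
Qed.

Lemma open_measurable_rV A : open A -> measurable A.
Proof. by move/open_coord_open/coord_open_measurable. Qed.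

Lemma measurable_eball x (r : R) : measurable (eball x r).
Proof.
have [r0|r0] := leP r 0.
  rewrite (_ : eball x r = set0)// -subset0 => y /= /(le_lt_trans (enorm_ge0 _)).
  by rewrite ltNge r0.
pose f (y : 'rV[R]_N) := \sum_(i < N) (y ord0 i - x ord0 i) ^+ 2.
have mf : measurable_fun setT f.
  apply: measurable_sum => i; apply: measurable_funX.
  by apply: measurable_funB => //; exact: measurable_coord.
rewrite (_ : eball x r = f @^-1` [set` `]-oo, r ^+ 2[]).
  by rewrite -[X in measurable X]setTI; exact: mf.
have E y : (enorm (y - x) < r) = (f y < r ^+ 2).
  rewrite -(@ltr_pXn2r _ 2)// ?nnegrE ?enorm_ge0 ?ltW// enorm_sqr /f.
  by under eq_bigr do rewrite !mxE.
by apply/seteqP; split=> y; rewrite /eball/= in_itv/= E.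
Qed.

Lemma lipschitz_measurable Omega (L : R) (phi : 'rV[R]_N -> R) :
  open Omega -> 0 <= L ->
  (forall x y, Omega x -> Omega y -> `|phi x - phi y| <= L * enorm (x - y)) ->
  measurable_fun Omega phi.
Proof.
move=> oO L0 phiL.
apply: (measurability _ (RGenOInfty.measurableE R)) => /=.
move=> _ [_ [a ->] <-]; apply: coord_open_measurable => x [Ox /=].
rewrite in_itv/= andbT => ax.
have [e e0 xO] := open_coord_open oO Ox.
(* Within sup-norm distance [d] of [x] the function drops by at most [L * N * d]; the [+ 1] makes
   this strictly less than [phi x - a] and keeps the denominator positive. *)
pose d := Num.min e ((phi x - a) / (L * N%:R + 1)).
have LN : 0 < L * N%:R + 1 by rewrite ltr_wpDl// mulr_ge0.
exists d; first by rewrite lt_min e0/= divr_gt0// subr_gt0.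
move=> y xy; have Oy : Omega y.
  by apply: xO => i; rewrite (lt_le_trans (xy i))// ge_min lexx.
split => //=; rewrite in_itv/= andbT.
have d0 : 0 < d by rewrite lt_min e0 divr_gt0// subr_gt0.
have dle : d * (L * N%:R + 1) <= phi x - a.
  by rewrite -ler_pdivlMr// ge_min lexx orbT.
have : L * enorm (x - y) <= L * (N%:R * d).
  rewrite ler_wpM2l// (le_trans (enorm_le_sum _))//.
  rewrite -[N in N%:R]card_ord mulr_natl -sumr_const ler_sum// => i _.
  by rewrite !mxE ltW.
have := phiL x y Ox Oy; rewrite ler_distl => /andP[_].
nra.
Qed.

End rV_borel.

(** * Scaling of Lebesgue measure and the volume of balls *)

Lemma pushforward_measure d1 d2 (T1 : measurableType d1)
    (T2 : measurableType d2) (R : realType) (m : {measure set T1 -> \bar R})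
    (f : T1 -> T2) : measurable_fun setT f ->
  exists p : {measure set T2 -> \bar R}, p = pushforward m f :> (set T2 -> \bar R).
Proof. by move=> mf; unshelve eexists (pushforward m f). Qed.

Section lebesgue_affine.
Variable R : realType.

(** As a function of [A] the right-hand side is a measure that agrees with Lebesgue measure on
    half-open intervals, so uniqueness applies. *)
Lemma lebesgue_measure_affine (a b : R) (A : set (measurableTypeR R)) :
  0 < a -> measurable A ->
  lebesgue_measure A =
  (a%:E * lebesgue_measure
    ((fun x : measurableTypeR R => (a * x + b)%R : measurableTypeR R)
       @^-1` A))%E.
Proof.
move=> a0 mA; pose f (x : measurableTypeR R) : measurableTypeR R := a * x + b.
have mf : measurable_fun setT f.
  by apply: measurable_funD => //; exact: mulrl_measurable.
(* The pushforward must be bundled as a measure before [mscale] and the uniqueness theorem can take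
   it. *)
have [p pE] := pushforward_measure (@lebesgue_measure R) mf.
pose m := mscale (NngNum (ltW a0)) p.
rewrite [RHS](_ : _ = m A); last by rewrite /m /mscale/= pE.
apply: (@lebesgue_measure_unique _ m) => // X [[c e] _ <-] /=.
rewrite /m /mscale /= pE /pushforward.
rewrite (_ : f @^-1` _ = `](c - b) / a, (e - b) / a]%classic); last first.
  apply/seteqP; split=> x; rewrite /f /= !in_itv/=;
  rewrite ltr_pdivrMr// ler_pdivlMr// ltrBlDr lerBrDr mulrC; lra.
rewrite lebesgue_measure_itv/=.
transitivity (a%:E * (if ((c - b) / a)%:E < ((e - b) / a)%:E then
    ((e - b) / a)%:E - ((c - b) / a)%:E else 0))%E; last first.
  by congr (_ * _)%E; rewrite (lebesgue_measure_itv `](c - b) / a, (e - b) / a]).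
rewrite !lte_fin ltr_pM2r ?invr_gt0// ltrD2r.
case: ifPn => ce; last by rewrite mule0.
rewrite -!EFinD -EFinM; congr EFin; field; lra.
Qed.

(** Induction on the dimension: with the first coordinate split off, both sides agree on rectangles,
    and a product measure is determined by its values there. *)
Lemma lebesgue_rV_affine N (a : R) (v : 'rV[R]_N) (A : set 'rV[R]_N) :
  0 < a -> measurable A ->
  lebesgue_rV R N A =
  ((a ^+ N)%:E * lebesgue_rV R N ((fun x => a *: x + v)%R @^-1` A))%E.
Proof.
move=> a0; have mphi k (w : 'rV[R]_k) :
    measurable_fun setT (fun x : 'rV[R]_k => a *: x + w).
  apply: measurable_fun_rV => i; under eq_fun do rewrite !mxE.
  apply: measurable_funD => //; apply: measurable_funM => //.
  exact: measurable_coord.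
elim: N v A => [|N IH] v A mA.
  rewrite expr0 mul1e; congr (_ _); apply/seteqP; split => x /=;
  by rewrite (_ : a *: x + v = x)//; apply/rowP => -[].
pose v1 := v ord0 ord0; pose v2 := \row_i v ord0 (lift ord0 i).
pose f (x : measurableTypeR R) : measurableTypeR R := a * x + v1.
pose g (x : 'rV[R]_N) := a *: x + v2.
pose h (p : measurableTypeR R * 'rV[R]_N) := (f p.1, g p.2).
have mf : measurable_fun setT f.
  by apply: measurable_funD => //; exact: mulrl_measurable.
have mg : measurable_fun setT g by exact: mphi.
have mh : measurable_fun setT h.
  by apply: measurable_fun_pair; apply: measurableT_comp.
have an0 : 0 <= a ^+ N.+1 by rewrite exprn_ge0// ltW.
have [p pE] := pushforward_measure (@lebesgue_measure R \x lebesgue_rV R N)%E mh.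
pose m := mscale (NngNum an0) p.
rewrite /= /lebesgue_cons {1 2}/pushforward.
have mE (x : 'rV[R]_N.+1) k : (a *: x + v) ord0 k = a * x ord0 k + v ord0 k.
  by rewrite !mxE.
have hE q : a *: rV_cons q + v = rV_cons (h q).
  apply/rowP => i; case: (unliftP ord0 i) => [j ->|->].
    by rewrite mE !rV_consS /h /g /v2 /= !mxE.
  by rewrite mE !rV_cons0.
have -> : rV_cons (N:=N) @^-1` ((fun x => a *: x + v) @^-1` A) =
    h @^-1` (rV_cons (N:=N) @^-1` A).
  by rewrite /preimage; apply/funext => q /=; rewrite hE.
rewrite [RHS](_ : _ = m (rV_cons (N:=N) @^-1` A)); last first.
  by rewrite /m /mscale/= pE.
apply: (product_measure_unique (m' := m)).
  move=> B C mB mC; transitivity ((a ^+ N.+1)%:E * p (B `*` C))%E; first by [].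
  rewrite pE /pushforward.
  rewrite (_ : h @^-1` _ = (f @^-1` B) `*` (g @^-1` C)); last first.
    by apply/seteqP; split=> -[? ?].
  transitivity ((a ^+ N.+1)%:E * (lebesgue_measure (f @^-1` B) *
      lebesgue_rV R N (g @^-1` C)))%E.
    congr (_ * _)%E; apply: product_measure1E.
    - by rewrite -[X in measurable X]setTI; exact: mf.
    - by rewrite -[X in measurable X]setTI; exact: mg.
  transitivity ((a%:E * lebesgue_measure (f @^-1` B)) *
      ((a ^+ N)%:E * lebesgue_rV R N (g @^-1` C)))%E.
    by rewrite exprS EFinM -!muleA; congr (_ * _)%E; rewrite muleCA.
  congr (_ * _)%E; apply/esym; last exact: IH.
  exact: (lebesgue_measure_affine v1 a0).
by rewrite -[X in measurable X]setTI; exact: measurable_rV_cons.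
Qed.

Lemma lebesgue_rV_eball N (x : 'rV[R]_N) (r : R) : 0 < r ->
  lebesgue_rV R N (eball x r) = ((r ^+ N)%:E * lebesgue_rV R N (eball 0 1))%E.
Proof.
move=> r0; rewrite (lebesgue_rV_affine x r0)//; last exact: measurable_eball.
congr (_ * lebesgue_rV R N _)%E; apply/seteqP; split=> y; rewrite /eball /=.
  by rewrite addrK subr0 enormZ ?ltW// -ltr_pdivlMl// mulVf// gt_eqF.
by rewrite addrK subr0 enormZ ?ltW// => ?; rewrite -ltr_pdivlMl// mulVf// gt_eqF.
Qed.

Lemma lebesgue_rV_cube N (x : 'rV[R]_N) (r : R) : 0 <= r ->
  lebesgue_rV R N [set y | forall i, `]x ord0 i - r, x ord0 i + r[%classic (y ord0 i)]
  = ((2 * r) ^+ N)%:E.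
Proof.
move=> r0; rewrite (@lebesgue_rV_box _ _
  (fun i => `]x ord0 i - r, x ord0 i + r[%classic)).
  rewrite (eq_bigr (fun=> (2 * r)%:E)).
    rewrite -[RHS]/(((2 * r) ^+ N)%:E); elim: (N) => [|k IH]; first by rewrite big_ord0.
    by rewrite big_ord_recl IH exprS EFinM.
  move=> i _; rewrite lebesgue_measure_itv/= lte_fin; case: ifPn => [_|].
    by rewrite -EFinD; congr EFin; ring.
  by rewrite -leNgt => h; congr EFin; lra.
by move=> i; exact: measurable_itv.
Qed.

Lemma eball_sub_cube N (x : 'rV[R]_N) (r : R) :
  eball x r `<=` [set y | forall i, `]x ord0 i - r, x ord0 i + r[%classic (y ord0 i)].
Proof.
move=> y yx i /=; rewrite in_itv/= -ltr_distl (le_lt_trans _ yx)//.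
by have := ler_coord_enorm (y - x) i; rewrite !mxE.
Qed.

Lemma measurable_cube N (x : 'rV[R]_N) (r : R) :
  measurable [set y : 'rV[R]_N |
    forall i, `]x ord0 i - r, x ord0 i + r[%classic (y ord0 i)].
Proof.
apply: (@measurable_box _ _ (fun i => `]x ord0 i - r, x ord0 i + r[%classic)) => i.
exact: measurable_itv.
Qed.

Lemma lebesgue_rV_eball_le N (x : 'rV[R]_N) (r : R) : 0 <= r ->
  (lebesgue_rV R N (eball x r) <= ((2 * r) ^+ N)%:E)%E.
Proof.
move=> r0; rewrite -(lebesgue_rV_cube x r0).
apply: le_measure; rewrite ?inE; [exact: measurable_eball|exact: measurable_cube|].
exact: eball_sub_cube.
Qed.

Definition unit_ball_volume N : R := fine (lebesgue_rV R N (eball 0 1)).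

Lemma unit_ball_volumeE N :
  lebesgue_rV R N (eball 0 1) = (unit_ball_volume N)%:E.
Proof.
rewrite /unit_ball_volume fineK// ge0_fin_numE//.
by rewrite (le_lt_trans (lebesgue_rV_eball_le _ ler01))// ltry.
Qed.

(** The unit ball contains the cube of half-side [1/(N+1)], because the norm is at most the sum of
    the absolute coordinates. *)
Lemma unit_ball_volume_gt0 N : 0 < unit_ball_volume N.
Proof.
rewrite -lte_fin -unit_ball_volumeE.
have N0 : 0 < (N.+1)%:R^-1 :> R by rewrite invr_gt0.
apply: (@lt_le_trans _ _ ((2 * N.+1%:R^-1) ^+ N)%:E).
  by rewrite lte_fin exprn_gt0// mulr_gt0.
rewrite -(lebesgue_rV_cube (0 : 'rV[R]_N) (ltW N0)).
apply: le_measure; rewrite ?inE; [exact: measurable_cube|exact: measurable_eball|].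
move=> y yi; rewrite /eball /= subr0 (le_lt_trans (enorm_le_sum _))//.
apply: (@le_lt_trans _ _ (\sum_(i < N) N.+1%:R^-1)).
  apply: ler_sum => i _; have := yi i.
  by rewrite /= in_itv/= mxE -ltr_distl subr0 => /ltW.
by rewrite sumr_const card_ord -[_ *+ N]mulr_natr ltr_pdivrMl ?ltr0Sn// mulr1 ltr_nat.
Qed.

Lemma lebesgue_rV_eballE N (x : 'rV[R]_N) (r : R) : 0 < r ->
  lebesgue_rV R N (eball x r) = (r ^+ N * unit_ball_volume N)%:E.
Proof. by move=> r0; rewrite lebesgue_rV_eball// unit_ball_volumeE -EFinM. Qed.

Lemma lebesgue_rV_lty N (A : set 'rV[R]_N) (r : R) : measurable A ->
  A `<=` eball 0 r -> (lebesgue_rV R N A < +oo)%E.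
Proof.
move=> mA Ar.
apply: (@le_lt_trans _ _ (lebesgue_rV R N (eball 0 `|r|))).
  apply: le_measure; rewrite ?inE//; first exact: measurable_eball.
  by move=> x /Ar; rewrite /eball/= => /lt_le_trans; apply; exact: ler_norm.
by rewrite (le_lt_trans (lebesgue_rV_eball_le _ (normr_ge0 r)))// ltry.
Qed.

End lebesgue_affine.

(** * Measures and integrals over finite families of sets *)

Section measure_lemmas.
Context d (T : measurableType d) (R : realType).

Lemma bigcup_ord n (F : 'I_n -> set T) :
  \bigcup_i F i = \big[setU/set0]_(i < n) F i.
Proof.
rewrite -bigcup_seq; apply/seteqP; split => x [i _ Fx]; exists i => //=.
exact: mem_index_enum.
Qed.

Lemma measure_bigcup_ord (mu : {measure set T -> \bar R}) n
    (F : 'I_n -> set T) : (forall i, measurable (F i)) -> trivIset setT F ->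
  (mu (\bigcup_i F i) = \sum_(i < n) mu (F i))%E.
Proof. by move=> mF tF; rewrite bigcup_ord measure_bigsetU_ord. Qed.

Lemma measurable_bigcup_ord n (F : 'I_n -> set T) :
  (forall i, measurable (F i)) -> measurable (\bigcup_i F i).
Proof. by move=> mF; rewrite bigcup_ord; apply: bigsetU_measurable. Qed.

Lemma measure_bigcup_ord_le (mu : {measure set T -> \bar R}) n
    (F : 'I_n -> set T) : (forall i, measurable (F i)) ->
  (mu (\bigcup_i F i) <= \sum_(i < n) mu (F i))%E.
Proof.
move=> mF; rewrite bigcup_ord.
(* [Boole_inequality] is about sequences of sets, so the family is continued by the empty set. *)
pose G k := if insub k is Some i then F i else set0.
have GE (i : 'I_n) : G i = F i by rewrite /G valK.
under eq_bigr do rewrite -GE; under [in leRHS]eq_bigr do rewrite -GE.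
apply: Boole_inequality => k kn; rewrite /G insubT/=; exact: mF.
Qed.

Lemma sum_measureI_le (mu : {measure set T -> \bar R}) n (F : 'I_n -> set T)
    (A : set T) : (forall i, measurable (F i)) -> trivIset setT F ->
  measurable A -> (\sum_(i < n) mu (F i `&` A) <= mu A)%E.
Proof.
move=> mF tF mA; rewrite -measure_bigcup_ord; last 2 first.
- by move=> i; exact: measurableI.
- exact: trivIset_setIr.
apply: le_measure; rewrite ?inE//.
  by apply: measurable_bigcup_ord => i; exact: measurableI.
by move=> x [i _ []].
Qed.

Lemma sum_fine_measureI_le (mu : {measure set T -> \bar R}) n
    (F : 'I_n -> set T) (A : set T) :
  (forall i, measurable (F i)) -> trivIset setT F ->
  measurable A -> (mu A < +oo)%E ->
  \sum_(i < n) fine (mu (F i `&` A)) <= fine (mu A).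
Proof.
move=> mF tF mA Aoo.
have fA i : mu (F i `&` A) \is a fin_num.
  rewrite ge0_fin_numE// (le_lt_trans _ Aoo)// le_measure ?inE//.
  exact: measurableI.
rewrite -lee_fin fineK ?ge0_fin_numE// (le_trans _ (sum_measureI_le mu mF tF mA))//.
by rewrite -sumEFin lee_sum// => i _; rewrite fineK.
Qed.

(** Meant for [u \o T], which takes the constant value [u (Z j)] on the cell [U j]. *)
Lemma Rintegral_step (mu : {finite_measure set T -> \bar R}) n
    (D : set T) (F : 'I_n -> set T) (c : 'I_n -> R) (f : T -> R) :
  measurable D -> (forall i, measurable (F i)) ->
  (forall x, D x -> f x = \sum_(i < n) c i * \1_(F i) x) ->
  (\int[mu]_(x in D) f x)%R = \sum_(i < n) c i * fine (mu (F i `&` D)).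
Proof.
move=> mD mF fE; rewrite /Rintegral.
have iF i : mu.-integrable D (fun x => (\1_(F i) x)%:E).
  exact: integrableS (integrable_indic mu (mF i)).
have -> : (\int[mu]_(x in D) (f x)%:E =
    \int[mu]_(x in D) (\sum_(i < n) (c i)%:E * (\1_(F i) x)%:E))%E.
  apply: eq_integral => x; rewrite inE => /fE ->.
  by rewrite -sumEFin; apply: eq_bigr => i _; rewrite EFinM.
rewrite integral_sum//; last by move=> i; exact: integrableZl.
have fI i : mu (F i `&` D) \is a fin_num.
  by rewrite fin_num_measure//; exact: measurableI.
rewrite (eq_bigr (fun i => (c i * fine (mu (F i `&` D)))%:E)).
  by rewrite sumEFin.
by move=> i _; rewrite integralZl// integral_indic// EFinM fineK.
Qed.

End measure_lemmas.

(** * Comparison of [mu] with Lebesgue measure *)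

Section lipschitz_density.
Variables (R : realType) (N : nat) (Omega : set 'rV[R]_N).
Variables (phi0 phi1 L : R) (mu : probability 'rV[R]_N R).
Variable phi : 'rV[R]_N -> R.
Hypotheses (phi0_gt0 : 0 < phi0) (L_ge0 : 0 <= L).
Hypothesis oO : open Omega.
Hypothesis density : has_lipschitz_density Omega phi0 phi1 L mu phi.
Local Notation leb := (lebesgue_rV R N).

Lemma density_ge0 x : 0 <= phi x.
Proof.
have [h _ h0 _] := density.
have [/h/andP[+ _]|/h0 ->//] := pselect (Omega x).
by apply: le_trans; exact: ltW.
Qed.

Lemma density_le x : 0 <= phi1 -> phi x <= phi1.
Proof.
move=> p1; have [h _ h0 _] := density.
by have [/h/andP[]|/h0 ->//] := pselect (Omega x).
Qed.

Lemma measurable_density : measurable_fun setT phi.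
Proof.
have [_ phiL h0 _] := density.
rewrite (_ : phi = phi \_ Omega); last first.
  apply/funext => x; rewrite patchE; case: ifPn => //.
  by rewrite notin_setE => /h0.
apply: (measurable_restrictT phi (open_measurable_rV oO)).1.
exact: lipschitz_measurable phiL.
Qed.

Let mphi A : measurable_fun A (EFin \o phi).
Proof. by apply/measurable_EFinP; apply: measurable_funTS; exact: measurable_density. Qed.

Lemma density_measure_le A : 0 <= phi1 -> measurable A ->
  (mu A <= phi1%:E * leb A)%E.
Proof.
move=> p1 mA; have [_ _ _ ->//] := density.
rewrite -integral_cst//; apply: ge0_le_integral => //.
- by move=> x _; rewrite lee_fin density_ge0.
- by move=> x _; rewrite lee_fin density_le.
Qed.

Lemma density_measure_ge A : measurable A -> A `<=` Omega ->
  (phi0%:E * leb A <= mu A)%E.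
Proof.
move=> mA AO; have [h _ _ ->//] := density.
rewrite -integral_cst//; apply: ge0_le_integral => //.
- by move=> x _; rewrite lee_fin ltW.
- by move=> x /AO/h/andP[].
Qed.

End lipschitz_density.

(** * Elementary inequalities for averages, powers and suprema *)

Lemma weighted_average_diff (R : realType) n (u a b : 'I_n -> R) (K : R) :
  0 <= K -> (forall i, `|u i| <= K) -> (forall i, 0 <= a i) ->
  0 < \sum_(i < n) a i -> 0 < \sum_(i < n) b i ->
  `|(\sum_(i < n) u i * a i) / (\sum_(i < n) a i) -
    (\sum_(i < n) u i * b i) / (\sum_(i < n) b i)| <=
  2 * K * (\sum_(i < n) `|a i - b i|) / (\sum_(i < n) b i).
Proof.
move=> K0 uK a0; set A := \sum_(i < n) a i; set B := \sum_(i < n) b i.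
set X := \sum_(i < n) u i * a i; set Y := \sum_(i < n) u i * b i.
set E := \sum_(i < n) _ => A0 B0.
have XA : `|X| <= K * A.
  rewrite (le_trans (ler_norm_sum _ _ _))// mulr_sumr ler_sum// => i _.
  by rewrite normrM (ger0_norm (a0 i)) ler_wpM2r.
have XY : `|X - Y| <= K * E.
  rewrite -sumrB (le_trans (ler_norm_sum _ _ _))// mulr_sumr ler_sum// => i _.
  by rewrite -mulrBr normrM ler_wpM2r.
have AB : `|B - A| <= E.
  rewrite distrC -sumrB (le_trans (ler_norm_sum _ _ _))//.
(* Since [X / A] is an average of values bounded by [K], each of the two terms is at most
   [K * E / B]. *)
have -> : X / A - Y / B = X / A * ((B - A) / B) + (X - Y) / B.
  by field; rewrite !gt_eqF.
rewrite (le_trans (ler_normD _ _))// [leRHS](_ : _ = K * (E / B) + K * E / B); last first.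
  by field; rewrite gt_eqF.
have XAK : `|X / A| <= K.
  by rewrite normrM normfV (gtr0_norm A0) ler_pdivrMr.
apply: lerD; last by rewrite normrM normfV (gtr0_norm B0) ler_pM2r// invr_gt0.
by rewrite normrM ler_pM// normrM normfV (gtr0_norm B0) ler_pM2r// invr_gt0.
Qed.

(** Factor out [a - b]; each of the [n] monomials that remain has degree [n.-1] and is at most
    [M ^+ n.-1]. This bounds the volume of the annulus. *)
Lemma ler_subXX (R : realType) n (a b M : R) : 0 <= b -> b <= a -> a <= M ->
  a ^+ n - b ^+ n <= n%:R * (a - b) * M ^+ n.-1.
Proof.
move=> b0 ba aM; rewrite subrXX -mulrA mulrCA ler_wpM2l ?subr_ge0//.
rewrite -[n in n%:R]card_ord mulr_natl -sumr_const ler_sum// => i _.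
have nE : n.-1 = (n.-1 - i + i)%N.
  by rewrite subnK// -ltnS (leq_trans (ltn_ord i))// leqSpred.
rewrite {2}nE exprD -subn1 subnAC subn1 -subnS.
have a0 : 0 <= a by exact: le_trans ba.
apply: ler_pM; rewrite ?exprn_ge0// lerXn2r ?nnegrE//; lra.
Qed.

Lemma le_real_sup (R : realType) (A : set R) (a M : R) :
  (forall x, A x -> x <= M) -> A a -> a <= sup A.
Proof. by move=> AM Aa; apply: ub_le_sup => //; exists M. Qed.

(** * The cloud as an indexed family *)

Section cloud_sums.
Variables (R : realType) (N n : nat) (Z : 'I_n -> 'rV[R]_N).
Hypothesis Zinj : injective Z.

(** Distinct points leave [undup] nothing to remove, so sums over the cloud become sums over
    indices. *)
Lemma cloud_codom : cloud Z = codom Z.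
Proof.
by rewrite /cloud undup_id// /codom /image_mem map_inj_uniq// enum_uniq.
Qed.

Lemma sum_cloud_ball (u : 'rV[R]_N -> R) x r :
  \sum_(y <- cloud_ball Z x r) u y =
  \sum_(j < n) u (Z j) * (enorm (Z j - x) < r)%R%:R.
Proof.
rewrite /cloud_ball cloud_codom big_filter /codom /image_mem big_map.
rewrite big_enum_cond/= big_mkcond/=; apply: eq_bigr => j _.
by case: ifP; rewrite ?mulr1 ?mulr0.
Qed.

Lemma size_cloud_ball x r :
  (size (cloud_ball Z x r))%:R = \sum_(j < n) (enorm (Z j - x) < r)%R%:R :> R.
Proof.
have := sum_cloud_ball (fun=> 1) x r.
under [in X in _ = X -> _]eq_bigr do rewrite mul1r.
by move=> <-; rewrite big_const_seq count_predT iter_addr_0.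
Qed.

End cloud_sums.

Section cloud_facts.
Variables (R : realType) (N n : nat) (Z : 'I_n -> 'rV[R]_N).

Lemma mem_cloud j : Z j \in cloud Z.
Proof. by rewrite mem_undup codom_f. Qed.

Lemma mem_cloud_ball y x r :
  (y \in cloud_ball Z x r) = (enorm (y - x) < r) && (y \in cloud Z).
Proof. by rewrite mem_filter. Qed.

Lemma cloudP y : y \in cloud Z -> exists j, y = Z j.
Proof. by rewrite mem_undup => /codomP. Qed.

Lemma ler_cloud_norm (u : 'rV[R]_N -> R) j : `|u (Z j)| <= cloud_norm Z u.
Proof.
apply: (@le_bigmax_seq _ _ _ _ _ (Z j) xpredT (fun y => `|u y|)) => //.
exact: mem_cloud.
Qed.

Lemma cloud_norm_ge0 (u : 'rV[R]_N -> R) : 0 <= cloud_norm Z u.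
Proof. by rewrite /cloud_norm; elim/big_ind : _ => // x y x0 y0; rewrite le_max x0. Qed.

End cloud_facts.

(** * The operator inequality for a given transport map *)

Section transport.
Variables (R : realType) (N : nat) (phi0 phi1 L : R).
Variables (Omega : set 'rV[R]_N) (mu : probability 'rV[R]_N R).
Variable phi : 'rV[R]_N -> R.
Hypotheses (phi0_gt0 : 0 < phi0) (phi01 : phi0 <= phi1) (L_ge0 : 0 <= L).
Hypotheses (oO : open Omega) (bO : exists r, Omega `<=` eball 0 r).
Hypothesis density : has_lipschitz_density Omega phi0 phi1 L mu phi.
Variables (n : nat) (Z : 'I_n -> 'rV[R]_N) (C0 eps : R).
Variables (U : 'I_n -> set 'rV[R]_N) (phi_eps : 'rV[R]_N -> R).
Hypotheses (eps_gt0 : 0 < eps) (eps_lt : eps < 2^-1) (C0_ge0 : 0 <= C0).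
Hypothesis tP : transport_partition Z Omega phi C0 eps U phi_eps.
Local Notation leb := (lebesgue_rV R N).
Local Notation K := (C0 * eps ^+ 2).

Let mU j : measurable (U j). Proof. by have [[]] := tP. Qed.
Let tU : trivIset setT U. Proof. by have [[]] := tP. Qed.
Let UO : \bigcup_j U j = Omega. Proof. by have [[]] := tP. Qed.
Let UZ j : U j (Z j). Proof. by have [_ /(_ j)[]] := tP. Qed.
Let Ueps j x : U j x -> enorm (x - Z j) < eps ^+ 3.
Proof. by have [_ /(_ j)[_ h] _ _ _] := tP => /h. Qed.
Let phi1_ge0 : 0 <= phi1. Proof. by rewrite (le_trans _ phi01)// ltW. Qed.
Let K_ge0 : 0 <= K. Proof. by rewrite mulr_ge0// sqr_ge0. Qed.

Let U_uniq i j x : U i x -> U j x -> i = j.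
Proof. by move=> ix jx; apply: tU => //; exists x. Qed.

Let Zinj : injective Z.
Proof. by move=> i j ij; apply: (@U_uniq _ _ (Z i)); rewrite // ij. Qed.

Let leb_lty A : measurable A -> A `<=` Omega -> (leb A < +oo)%E.
Proof.
move=> mA AO; have [r Or] := bO.
by apply: (@lebesgue_rV_lty _ _ _ r) => // x /AO/Or.
Qed.

Lemma transport_density_ae :
  {ae leb, forall x, Omega x -> `|phi_eps x - phi x| <= K}.
Proof.
(* The norm is an essential supremum only if the whole space has positive measure, which the unit
   ball guarantees. *)
have [_ _ _ _] := tP; rewrite /Linfty_norm unlock ifT; last first.
  apply: (@lt_le_trans _ _ (leb (eball 0 1))).
    by rewrite unit_ball_volumeE lte_fin unit_ball_volume_gt0.
  by apply: le_measure; rewrite ?inE//; exact: measurable_eball.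
move/ess_supP; apply: filterS => x /= + Ox.
by rewrite patchE mem_set// lee_fin.
Qed.

(** The integrals of [phi_eps] and [phi] over [U j] are [1/n] and the mass of [U j]; the densities
    differ by at most [K] almost everywhere. *)
Lemma transport_cell_mass j :
  `|n%:R^-1 - fine (mu (U j))| <= K * fine (leb (U j)).
Proof.
have [_ _ [mphie phie0 _ _] Un _] := tP.
have UjO : U j `<=` Omega by rewrite -UO; exact: bigcup_sup.
have Uoo : leb (U j) \is a fin_num by rewrite ge0_fin_numE// leb_lty.
have muE : mu (U j) = (\int[leb]_(x in U j) (phi x)%:E)%E.
  by have [_ _ _ ->] := density.
have ae := transport_density_ae.
have mp : measurable_fun (U j) (EFin \o phi).
  apply/measurable_EFinP; apply: measurable_funTS.
  exact: measurable_density L_ge0 oO density.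
have mpe : measurable_fun (U j) (EFin \o phi_eps).
  apply/measurable_EFinP; apply: measurable_funS mphie => //.
  exact: open_measurable_rV.
have KE : (\int[leb]_(x in U j) (cst K%:E x) = (K * fine (leb (U j)))%:E)%E.
  by rewrite integral_cst// [RHS]EFinM fineK.
have p0 x : (0 <= (phi x)%:E)%E by rewrite lee_fin (density_ge0 phi0_gt0 density).
have pe0 x : U j x -> (0 <= (phi_eps x)%:E)%E by move=> /UjO/phie0; rewrite lee_fin.
have h1 : ((n%:R^-1)%:E <= mu (U j) + (K * fine (leb (U j)))%:E)%E.
  rewrite -(Un j) muE -KE -ge0_integralD//.
  apply: ae_ge0_le_integral => //.
  - by move=> x _; rewrite adde_ge0// lee_fin.
  - by apply: emeasurable_funD => //; exact: measurable_cst.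
  apply: filterS ae => x h Ujx; have := h (UjO _ Ujx).
  by rewrite ler_distl /= -EFinD lee_fin => /andP[_]; rewrite addrC.
have h2 : (mu (U j) <= (n%:R^-1)%:E + (K * fine (leb (U j)))%:E)%E.
  rewrite -(Un j) muE -KE -ge0_integralD//.
  apply: ae_ge0_le_integral => //.
  - by move=> x Ujx; rewrite adde_ge0// ?lee_fin//; exact: pe0.
  - by apply: emeasurable_funD => //; exact: measurable_cst.
  apply: filterS ae => x h Ujx; have := h (UjO _ Ujx).
  by rewrite ler_distl /= -EFinD lee_fin lerBlDr => /andP[].
have muf : mu (U j) \is a fin_num by rewrite fin_num_measure.
move: h1 h2; rewrite -(fineK muf) -!EFinD !lee_fin ler_distl => h1 h2.
by rewrite lerBlDr h2 h1.
Qed.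

Variables (T : 'rV[R]_N -> 'rV[R]_N) (x : 'rV[R]_N).
Hypothesis hT : transport_map Z Omega U T.
Hypothesis hx : inner_domain Omega eps x.

Let T_cell y j : U j y -> T y = Z j.
Proof. by move=> Ujy; apply/hT => //; rewrite -UO; exists j. Qed.

Let TZ j : T (Z j) = Z j. Proof. exact: T_cell. Qed.

Lemma inner_eball : eball x eps `<=` Omega.
Proof.
move=> y xy; have [Ox dx] := hx; apply: contrapT => nOy.
have : Defs.edist x (~` Omega) <= enorm (x - y).
  apply: ge_inf; last by exists y.
  by exists 0 => _ [z _ <-]; exact: enorm_ge0.
by rewrite leNgt enormB (lt_trans xy).
Qed.

(** [T] fixes the cloud points, so a pair from the cloud also competes on the right with the same
    value. Replacing the centre [Z i] by [x] costs [eps ^+ 3] in the first radius and [2 * eps ^+ 3]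
    in the second, which is exactly what the enlarged constants provide. *)
Lemma transport_sup (Lambda tau : R) (u : 'rV[R]_N -> R) :
  1 <= Lambda -> 1 <= tau ->
  cloud_max Z u Lambda tau eps (T x) <=
  domain_sup Omega (u \o T) (Lambda + eps ^+ 2) (tau + 2 * eps) eps x.
Proof.
move=> L1 t1; have [Ox _] := hx.
have [i _ Uix] : (\bigcup_j U j) x by rewrite UO.
rewrite (T_cell Uix).
apply: ge_sup.
  (* [ge_sup] needs a nonempty set: the centre paired with itself is admissible. *)
  exists ((u (Z i) + u (Z i)) / 2), (Z i), (Z i).
  rewrite !mem_cloud_ball mem_cloud !andbT.
  split=> //; first by rewrite subrr enorm0 mulr_gt0// (lt_le_trans _ L1).
  rewrite scaler_nat mulr2n addrK subrr enorm0 mulr_gt0 ?exprn_gt0//.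
  by rewrite (lt_le_trans _ t1).
move=> _ [y [y' [yB y'B ->]]].
move: yB y'B; rewrite !mem_cloud_ball.
move=> /andP[yi /cloudP[j yj]] /andP[y'i /cloudP[k y'k]].
(* A member is below the [sup] only once the set is known to be bounded; all values of [u \o T] on
   [Omega] are values of [u] on the cloud. *)
apply: (@le_real_sup _ _ _ (cloud_norm Z u)).
  move=> _ [z [h [[_ Oz] [_ Oh] ->]]].
  have [a _ az] : (\bigcup_j U j) (x + z) by rewrite UO.
  have [b _ bz] : (\bigcup_j U j) (x - z + h) by rewrite UO.
  rewrite /= (T_cell az) (T_cell bz).
  have := ler_cloud_norm Z u a; have := ler_cloud_norm Z u b.
  by rewrite !ler_norml => /andP[_ ?] /andP[_ ?]; lra.
have OZ l : Omega (Z l) by rewrite -UO; exists l.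
have xi := Ueps Uix.
(* Solves [x + z = y] and [x - z + h = y']. *)
exists (y - x), (y' - 2 *: x + y); split.
- split; last by rewrite addrC subrK yj.
  rewrite (le_lt_trans (ler_enorm_dist _ (Z i) _))//.
  rewrite (_ : (Lambda + eps ^+ 2) * eps = Lambda * eps + eps ^+ 3); last by ring.
  by rewrite ltrD// enormB.
- have <- : y' = x - (y - x) + (y' - 2 *: x + y).
    by apply/rowP => l; rewrite !mxE; ring.
  split; last by rewrite y'k.
  have -> : y' - 2 *: x + y = (y' - (2 *: Z i - y)) + 2 *: (Z i - x).
    by apply/rowP => l; rewrite !mxE; ring.
  apply: (le_lt_trans (ler_enormD _ _)); rewrite enormZ//.
  rewrite (_ : (tau + 2 * eps) * eps ^+ 2 = tau * eps ^+ 2 + 2 * eps ^+ 3); last by ring.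
  by rewrite ltrD// ltr_pM2l// enormB.
- have <- : y' = x - (y - x) + (y' - 2 *: x + y).
    by apply/rowP => l; rewrite !mxE; ring.
  by rewrite /= (addrC x) subrK yj y'k !TZ.
Qed.

(** Passing from [x] to [Z i] and from a point of [U j] to [Z j] changes distances by less than
    [eps ^+ 3] each; the radii [r1] and [r2] absorb both changes. *)
Local Notation r1 := (eps - 2 * eps ^+ 3).
Local Notation r2 := (eps + 2 * eps ^+ 3).

Let eps3 : 0 < eps ^+ 3. Proof. exact: exprn_gt0. Qed.
Let eps2 : eps ^+ 2 <= 4^-1.
Proof. have := eps_gt0; have := eps_lt; nra. Qed.
Let eps3E : eps ^+ 3 = eps * eps ^+ 2. Proof. by rewrite exprS. Qed.

Let ann := eball x r2 `\` eball x r1.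
Let ball_j i j := (enorm (Z j - Z i) < eps)%R.

Let mann : measurable ann.
Proof. by apply: measurableD; exact: measurable_eball. Qed.

(** If [Z j] is outside the ball around [Z i], the part of [U j] within [eps] of [x] lies in [ann].
    If it is inside, all of [U j] lies within [r2] of [x], and the error consists of the mass error
    of the whole cell and the mass of [U j] outside [eball x eps], which again lies in [ann]. *)
Lemma transport_cell_error i j : U i x ->
  `|n%:R^-1 * (ball_j i j)%:R - fine (mu (U j `&` eball x eps))| <=
  K * fine (leb (U j `&` eball x r2)) + phi1 * fine (leb (U j `&` ann)).
Proof.
move=> Uix; have xi := Ueps Uix.
have UjO A : U j `&` A `<=` Omega by move=> y [Uy _]; rewrite -UO; exists j.
have fl A : measurable A -> leb (U j `&` A) \is a fin_num.
  by move=> mA; rewrite ge0_fin_numE// leb_lty//; exact: measurableI.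
have fm A : measurable A -> mu A \is a fin_num by move=> mA; rewrite fin_num_measure.
have mB r : measurable (eball x r) by exact: measurable_eball.
have mann_le A : measurable A -> A `<=` U j `&` ann ->
    fine (mu A) <= phi1 * fine (leb (U j `&` ann)).
  move=> mA AU; rewrite -lee_fin fineK ?fm// EFinM fineK ?fl//.
  apply: (@le_trans _ _ (mu (U j `&` ann))).
    by apply: le_measure; rewrite ?inE//; exact: measurableI.
  apply: (density_measure_le phi0_gt0 L_ge0 oO density) => //.
  exact: measurableI.
have fge0 A : 0 <= fine (leb A) by rewrite fine_ge0.
rewrite /ball_j; have [ji|ji] := ltP (enorm (Z j - Z i)) eps; last first.
  rewrite mulr0 sub0r normrN ger0_norm ?fine_ge0//.
  rewrite (ler_wpDl (mulr_ge0 K_ge0 (fge0 _)))//.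
  apply: mann_le; first exact: measurableI.
  move=> y [Uy yx]; split => //; split.
    by rewrite /eball/= in yx *; rewrite (lt_trans yx)// ltrDl mulr_gt0.
  move=> yr1; move: ji; rewrite leNgt => /negP; apply.
  have := Ueps Uy; have := ler_enorm_dist (Z j) y (Z i).
  have := ler_enorm_dist y x (Z i); rewrite /eball/= in yr1.
  rewrite (enormB (Z j) y); lra.
have Ur2 : U j `&` eball x r2 = U j.
  apply/setIidPl => y Uy; rewrite /eball/=.
  have := Ueps Uy; have := ler_enorm_dist y (Z j) x.
  have := ler_enorm_dist (Z j) (Z i) x; rewrite (enormB (Z i)); lra.
rewrite mulr1 Ur2.
have muE : fine (mu (U j)) =
    fine (mu (U j `&` eball x eps)) + fine (mu (U j `\` eball x eps)).
  rewrite -fineD ?fm//; [|exact: measurableI|exact: measurableD].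
  rewrite setIC addeC -measureU//=; last first.
  - by apply/seteqP; split=> // y [[_ nb] [b _]].
  - exact: measurableI.
  - exact: measurableD.
  congr (fine (mu _)); apply/seteqP; split => y /=; last by case=> -[].
  by move=> Uy; have [By|By] := pselect (eball x eps y); [right|left].
rewrite (_ : _ - _ = (n%:R^-1 - fine (mu (U j))) + fine (mu (U j `\` eball x eps))).
  rewrite (le_trans (ler_normD _ _))// lerD ?transport_cell_mass//.
  rewrite ger0_norm ?fine_ge0//; apply: mann_le; first exact: measurableD.
  move=> y [Uy yeps]; split => //; split.
    by move: Uy; rewrite -{1}Ur2 => -[].
  move=> yr1; apply: yeps; rewrite /eball/= in yr1 *.
  by rewrite (lt_trans yr1)// gtrBl mulr_gt0.
by rewrite muE; ring.
Qed.

Let omega := unit_ball_volume R N.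

(** As the cells are disjoint, the cell errors add up to at most [K] times the volume of the ball of
    radius [r2] plus [phi1] times that of [ann]. Writing the radii as [eps * (1 -+ 2 * eps ^+ 2)]
    with second factor at most 2 shows that both terms are of order [eps ^+ (N + 2)]. *)
Lemma transport_error i : U i x ->
  \sum_(j < n) `|n%:R^-1 * (ball_j i j)%:R - fine (mu (U j `&` eball x eps))| <=
  2 ^+ N * (C0 + 4 * N%:R * phi1) * omega * eps ^+ 2 * eps ^+ N.
Proof.
move=> Uix; have e0 := eps_gt0; have := eps3; rewrite eps3E => e3.
have o0 : 0 < omega := unit_ball_volume_gt0 R N.
have r1E : r1 = eps * (1 - 2 * eps ^+ 2) by ring.
have r2E : r2 = eps * (1 + 2 * eps ^+ 2) by ring.
have s0 : 0 <= 1 - 2 * eps ^+ 2 by have := eps2; lra.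
have r1_gt0 : 0 < r1 by rewrite r1E mulr_gt0//; have := eps2; lra.
have r2_gt0 : 0 < r2 by rewrite addr_gt0// mulr_gt0.
have mB r : measurable (eball x r) by exact: measurable_eball.
have b2 : leb (eball x r2) = (r2 ^+ N * omega)%:E by rewrite lebesgue_rV_eballE.
have b1 : leb (eball x r1) = (r1 ^+ N * omega)%:E by rewrite lebesgue_rV_eballE.
have annE : leb ann = ((r2 ^+ N - r1 ^+ N) * omega)%:E.
  have I1 : eball x r2 `&` eball x r1 = eball x r1.
    by apply/setIidPr => y; rewrite /eball/= => /lt_trans; apply; have := eps3; lra.
  transitivity (leb (eball x r2) - leb (eball x r2 `&` eball x r1))%E.
    have b2oo : (leb (eball x r2) < +oo)%E by rewrite b2 ltry.
    by apply: measureD.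
  by rewrite I1 b1 b2 mulrBl EFinB.
apply: (@le_trans _ _ (K * (r2 ^+ N * omega) + phi1 * ((r2 ^+ N - r1 ^+ N) * omega))).
  apply: (@le_trans _ _ (\sum_(j < n) (K * fine (leb (U j `&` eball x r2)) +
      phi1 * fine (leb (U j `&` ann))))).
    by apply: ler_sum => j _; exact: transport_cell_error.
  rewrite big_split/= -!mulr_sumr lerD// ler_wpM2l//.
    have b2oo : (leb (eball x r2) < +oo)%E by rewrite b2 ltry.
    apply: (le_trans (sum_fine_measureI_le mU tU _ b2oo)) => //.
    have <- : fine (leb (eball x r2)) = r2 ^+ N * omega by rewrite b2.
    exact: lexx.
  have annoo : (leb ann < +oo)%E by rewrite annE ltry.
  apply: (le_trans (sum_fine_measureI_le mU tU _ annoo)) => //.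
  have <- : fine (leb ann) = (r2 ^+ N - r1 ^+ N) * omega by rewrite annE.
  exact: lexx.
rewrite r1E r2E !exprMn -mulrBr.
have p2 : (1 + 2 * eps ^+ 2) ^+ N <= 2 ^+ N.
  by rewrite lerXn2r ?nnegrE//; have := eps2; have := sqr_ge0 eps; lra.
have pd : (1 + 2 * eps ^+ 2) ^+ N - (1 - 2 * eps ^+ 2) ^+ N <=
    N%:R * (4 * eps ^+ 2) * 2 ^+ N.
  apply: (le_trans (@ler_subXX R N _ _ 2 s0 _ _)).
  - by have := sqr_ge0 eps; lra.
  - by have := eps2; lra.
  rewrite (_ : 1 + 2 * eps ^+ 2 - _ = 4 * eps ^+ 2); last by ring.
  apply: ler_wpM2l; first by rewrite !mulr_ge0// ltW.
  by rewrite ler_weXn2l ?ler1n// leq_pred.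
have eN : 0 < eps ^+ N by rewrite exprn_gt0.
rewrite [leRHS](_ : _ = K * (eps ^+ N * 2 ^+ N * omega) +
   phi1 * (eps ^+ N * (N%:R * (4 * eps ^+ 2) * 2 ^+ N) * omega)); last by ring.
by rewrite lerD// ler_wpM2l// ler_wpM2r ?(ltW o0)// ler_wpM2l// ltW.
Qed.

Lemma transport_average (u : 'rV[R]_N -> R) :
  (size (cloud_ball Z (T x) eps))%:R^-1 * (\sum_(y <- cloud_ball Z (T x) eps) u y) <=
  (fine (mu (eball x eps)))^-1 * (\int[mu]_(y in eball x eps `&` Omega) (u \o T) y)%R +
  2 ^+ N.+1 * (C0 + 4 * N%:R * phi1) / phi0 * eps ^+ 2 * cloud_norm Z u.
Proof.
have [Ox _] := hx; have e0 := eps_gt0.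
have [i _ Uix] : (\bigcup_j U j) x by rewrite UO.
rewrite (T_cell Uix).
have mB : measurable (eball x eps) by exact: measurable_eball.
have BO : eball x eps `&` Omega = eball x eps by apply/setIidPl; exact: inner_eball.
have UoB : \bigcup_j (U j `&` eball x eps) = eball x eps.
  by rewrite -setI_bigcupl UO setIC BO.
have fm A : measurable A -> mu A \is a fin_num by move=> mA; rewrite fin_num_measure.
have n0 : (0 < n)%N by rewrite (leq_ltn_trans (leq0n i))// ltn_ord.
(* Both averages are weighted averages of the [u (Z j)], with weights [a] and [b]. The total of [b]
   is the mass of the ball, at least of order [eps ^+ N], which cancels that power in
   [transport_error]. *)
pose a j := n%:R^-1 * (ball_j i j)%:R : R.
pose b j := fine (mu (U j `&` eball x eps)).
have bE : \sum_(j < n) b j = fine (mu (eball x eps)).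
  rewrite -UoB measure_bigcup_ord; last 2 first.
  - by move=> j; exact: measurableI.
  - exact: trivIset_setIr.
  rewrite -sum_fine//= => j _; apply: fm; exact: measurableI.
have o0 : 0 < omega := unit_ball_volume_gt0 R N.
have b0 : phi0 * (eps ^+ N * omega) <= \sum_(j < n) b j.
  rewrite bE -lee_fin fineK ?fm// EFinM -(lebesgue_rV_eballE x)//.
  apply: (density_measure_ge phi0_gt0 L_ge0 oO density) => //.
  exact: inner_eball.
have pos : 0 < phi0 * (eps ^+ N * omega) by rewrite !mulr_gt0// exprn_gt0.
have a0 j : 0 <= a j by rewrite mulr_ge0.
have sa : 0 < \sum_(j < n) a j.
  (* The ball around [Z i] contains [Z i] itself. *)
  rewrite (bigD1 i)//= ltr_pwDl ?sumr_ge0//.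
  by rewrite /a /ball_j subrr enorm0 eps_gt0 mulr1 invr_gt0 ltr0n.
have -> : (size (cloud_ball Z (Z i) eps))%:R^-1 *
    (\sum_(y <- cloud_ball Z (Z i) eps) u y) =
    (\sum_(j < n) u (Z j) * a j) / (\sum_(j < n) a j).
  rewrite size_cloud_ball// sum_cloud_ball//.
  have -> : \sum_(j < n) u (Z j) * a j = n%:R^-1 *
      \sum_(j < n) u (Z j) * (enorm (Z j - Z i) < eps)%R%:R.
    by rewrite mulr_sumr; apply: eq_bigr => j _; rewrite mulrCA.
  move: sa; rewrite -mulr_sumr => sa.
  rewrite invfM invrK mulrACA mulrC [in RHS]mulrC.
  rewrite mulVf ?mulr1// pnatr_eq0 -lt0n//.
rewrite BO (@Rintegral_step _ _ _ mu n _ U (fun j => u (Z j)))//; last first.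
  move=> y By; have [j _ Ujy] : (\bigcup_j U j) y by rewrite UO; exact: inner_eball.
  rewrite /= (T_cell Ujy) (bigD1 j)//= indicE mem_set// mulr1.
  rewrite big1 ?addr0// => k kj; rewrite indicE memNset ?mulr0// => Uky.
  by move: kj; rewrite (U_uniq Uky Ujy) eqxx.
rewrite -bE -/b [_^-1 * _]mulrC -lerBlDl.
have uK j : `|u (Z j)| <= cloud_norm Z u by exact: ler_cloud_norm.
apply: (le_trans (ler_norm _)).
apply: (le_trans (weighted_average_diff (cloud_norm_ge0 Z u) uK a0 sa
  (lt_le_trans pos b0))).
rewrite ler_pdivrMr ?(lt_le_trans pos)//.
have := transport_error Uix; rewrite -/(a _) => err.
apply: (@le_trans _ _ (2 * cloud_norm Z u *
    (2 ^+ N * (C0 + 4 * N%:R * phi1) * omega * eps ^+ 2 * eps ^+ N))).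
  by rewrite ler_wpM2l ?mulr_ge0 ?cloud_norm_ge0.
apply: (@le_trans _ _ (2 ^+ N.+1 * (C0 + 4 * N%:R * phi1) / phi0 * eps ^+ 2 *
    cloud_norm Z u * (phi0 * (eps ^+ N * omega)))).
  rewrite le_eqVlt; apply/orP; left; apply/eqP; rewrite [2 ^+ N.+1]exprS.
  by field; rewrite gt_eqF.
rewrite ler_wpM2l// !mulr_ge0 ?cloud_norm_ge0 ?sqr_ge0 ?invr_ge0 ?(ltW phi0_gt0)//;
  try exact: ltW.
by rewrite addr_ge0// !mulr_ge0.
Qed.

(** The maximum loses nothing and the average loses a multiple of [eps ^+ 2], which the prefactor
    turns into a constant; the weight [beta <= 1] is absorbed. *)
Lemma transport_operator (beta Lambda tau : R) (u : 'rV[R]_N -> R) :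
  0 < beta <= 1 -> 1 <= Lambda -> 1 <= tau ->
  L_cloud Z beta Lambda tau eps u (T x) <=
  L_domain Omega mu beta (Lambda + eps ^+ 2) (tau + 2 * eps) eps (u \o T) x +
  2 ^+ N.+1 * (C0 + 4 * N%:R * phi1) / phi0 * cloud_norm Z u.
Proof.
move=> /andP[be0 be1] L1 t1; have e2 : 0 < eps ^+ 2 by rewrite exprn_gt0.
set C := _ / phi0.
have C_ge0 : 0 <= C * cloud_norm Z u.
  rewrite mulr_ge0 ?cloud_norm_ge0// divr_ge0 ?(ltW phi0_gt0)// mulr_ge0//.
  by rewrite addr_ge0// !mulr_ge0.
rewrite /L_cloud /L_domain -lerBlDl -mulrBr ler_pdivrMl//.
have h1 : (1 - beta) * cloud_max Z u Lambda tau eps (T x) <= (1 - beta) *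
    domain_sup Omega (u \o T) (Lambda + eps ^+ 2) (tau + 2 * eps) eps x.
  by rewrite ler_wpM2l ?subr_ge0// transport_sup.
have h2 := ler_wpM2l (ltW be0) (transport_average u).
have h3 : beta * (C * eps ^+ 2 * cloud_norm Z u) <= C * eps ^+ 2 * cloud_norm Z u.
  by rewrite ler_piMl// mulrAC mulr_ge0// ltW.
move: h1 h2 h3; rewrite -/C /=.
set p := _%:R^-1; set q := (fine _)^-1; set cm := cloud_max _ _ _ _ _ _.
set ds := domain_sup _ _ _ _ _ _; set I := (\int[mu]_(_ in _) _)%R.
set S := \sum_(_ <- _) _; set k := cloud_norm _ _.
clearbody C p q cm ds I S k.
lra.
Qed.

End transport.

(** * Chernoff bounds for the number of hits *)

Lemma expR_le_quadratic (R : realType) (x : R) :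
  `|x| <= 2^-1 -> expR x <= 1 + x + 2 * x ^+ 2.
Proof.
rewrite ler_norml => /andP[x1 x2].
(* This gives [expR x <= 1 / (1 - x)], and the product of [1 - x] and [1 + x + 2 * x ^+ 2] is
   [1 + x ^+ 2 * (1 - 2 * x)], at least 1 for [x <= 1/2]. *)
have h := expR_ge1Dx (- x); rewrite expRN in h.
have e0 := expR_gt0 x.
have h1 : expR x * (1 - x) <= 1.
  by rewrite -ler_pdivlMl// mulr1.
rewrite -(ler_pM2r (_ : 0 < 1 - x)); last by lra.
by apply: (le_trans h1); nra.
Qed.

Section chernoff.
Variables (R : realType) (d : measure_display) (S : measurableType d).
Variables (P : probability S R) (n : nat) (X : 'I_n -> set S) (p : R).
Hypothesis mX : forall i, measurable (X i).
Hypothesis p01 : 0 <= p <= 1.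

(* Independence is only given as a product rule for the events {Z_i in A_i}, so
   expectations are replaced by finite sums over the set of indices that hit. *)
Definition hit_pattern w : {set 'I_n} := [set i | `[< X i w >]].

Let cell (J : {set 'I_n}) : set S :=
  \bigcap_i (if i \in J then X i else ~` X i).

Hypothesis PX : forall J, P (cell J) =
  (\prod_(i < n) (if i \in J then p else 1 - p))%:E.

Let cellP w J : hit_pattern w = J <-> cell J w.
Proof.
split=> [<- i _|cJ].
  by rewrite inE; case: asboolP.
apply/setP => i; rewrite inE; have := cJ i I.
by case: ifP => _; case: asboolP.
Qed.

Let mcell J : measurable (cell J).
Proof.
rewrite /cell; apply: fin_bigcap_measurable => // i _.
by case: ifP => _ //; exact: measurableC.
Qed.

Let patternE (Q : pred {set 'I_n}) :
  [set w | Q (hit_pattern w)] = \big[setU/set0]_(J | Q J) cell J.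
Proof.
apply/seteqP; split => w /=.
  move=> Qw; rewrite (bigD1 (hit_pattern w))//=; left.
  exact/cellP.
by elim/big_ind : _ => [//|A B hA hB [/hA|/hB]//|J QJ /cellP ->].
Qed.

Lemma measurable_hit_pattern (Q : pred {set 'I_n}) :
  measurable [set w | Q (hit_pattern w)].
Proof. by rewrite patternE; apply: bigsetU_measurable. Qed.

Lemma hit_pattern_le (Q : pred {set 'I_n}) :
  (P [set w | Q (hit_pattern w)] <=
   (\sum_(J | Q J) \prod_(i < n) (if i \in J then p else 1 - p))%:E)%E.
Proof.
rewrite patternE -sumEFin.
suff [] : measurable (\big[setU/set0]_(J | Q J) cell J) /\
  (P (\big[setU/set0]_(J | Q J) cell J) <= \sum_(J | Q J)
    (\prod_(i < n) (if i \in J then p else 1 - p))%:E)%E by [].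
elim/big_rec2 : _ => [|J y A QJ [mA Ay]]; first by rewrite measure0.
split; first exact: measurableU.
apply: (le_trans (measureU2 _ _ _)) => //; apply: leeD => //.
by rewrite -PX.
Qed.

(** The moment generating function of the binomial law: a product of [n] equal sums, expanded over
    the subsets of indices. *)
Lemma exponential_moment (s : R) :
  \sum_(J : {set 'I_n}) expR (s * #|J|%:R) *
    \prod_(i < n) (if i \in J then p else 1 - p) =
  (1 + p * (expR s - 1)) ^+ n.
Proof.
transitivity (\prod_(i < n) (expR s * p + (1 - p))); last first.
  by rewrite prodr_const card_ord; congr (_ ^+ _); ring.
rewrite bigA_distr; apply: eq_bigr => J _.
rewrite expRM_natr -prodr_const [X in X * _]big_mkcond/= -big_split/=.
by apply: eq_bigr => i _; case: ifP; rewrite ?mul1r.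
Qed.

(** Markov's inequality for the exponential: on [Q] the factor [expR (s * (#|J| - a))] is at least
    1, and [1 + y <= expR y] bounds its total. The sign of [s] is left free to serve both tails. *)
Lemma chernoff_exponential (s a : R) (Q : pred {set 'I_n}) :
  (forall J, Q J -> 0 <= s * (#|J|%:R - a)) ->
  (P [set w | Q (hit_pattern w)] <=
   (expR (n%:R * p * (expR s - 1) - s * a))%:E)%E.
Proof.
move=> Qs; apply: (le_trans (hit_pattern_le Q)); rewrite lee_fin.
have w0 J : 0 <= \prod_(i < n) (if i \in J then p else 1 - p).
  by apply: prodr_ge0 => i _; case: ifP => _; have := p01; lra.
apply: (@le_trans _ _ (\sum_(J : {set 'I_n}) expR (- (s * a)) *
    (expR (s * #|J|%:R) * \prod_(i < n) (if i \in J then p else 1 - p)))).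
  rewrite big_mkcond/=; apply: ler_sum => J _.
  case: ifPn => QJ; last by rewrite !mulr_ge0 ?expR_ge0.
  rewrite mulrA -expRD ler_peMl// -[leLHS]expR0 ler_expR.
  by rewrite addrC -mulrBr Qs.
rewrite -mulr_sumr exponential_moment [X in _ <= expR X]addrC expRD ler_wpM2l ?expR_ge0//.
rewrite -mulrA expRM_natl lerXn2r ?nnegrE ?expR_ge0 ?expR_ge1Dx//.
have := expR_gt0 s; have := p01; nra.
Qed.

(** Each tail uses [s = t / 4] or its opposite, with threshold [a = n * p * (1 + 4 * s)]. By the
    quadratic bound the exponent is at most [n * p * (s + 2 * s ^+ 2 - s - 4 * s ^+ 2)], which is
    [- n * p * t ^+ 2 / 8]. *)
Lemma chernoff_relative (t : R) : 0 < t <= 1 ->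
  (P [set w | (p * t * n%:R < `|#|hit_pattern w|%:R - n%:R * p|)%R] <=
   (2 * expR (- (n%:R * p * t ^+ 2 / 8)))%:E)%E.
Proof.
move=> /andP[t0 t1].
pose Q1 (J : {set 'I_n}) := (n%:R * p * (1 + t) < #|J|%:R)%R.
pose Q2 (J : {set 'I_n}) := (#|J|%:R < n%:R * p * (1 - t))%R.
have np0 : 0 <= n%:R * p by rewrite mulr_ge0//; case/andP: p01.
have tail (s a : R) (Q : pred {set 'I_n}) : `|s| = t / 4 -> a = n%:R * p * (1 + 4 * s) ->
    (forall J, Q J -> 0 <= s * (#|J|%:R - a)) ->
    (P [set w | Q (hit_pattern w)] <= (expR (- (n%:R * p * t ^+ 2 / 8)))%:E)%E.
  move=> st aE Qs; apply: (le_trans (chernoff_exponential Qs)).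
  rewrite lee_fin ler_expR aE.
  have := @expR_le_quadratic R s; rewrite st.
  have t4 : t / 4 <= 2^-1 by lra.
  move=> /(_ t4) h.
  have s2 : s ^+ 2 = t ^+ 2 / 16.
    by rewrite -(real_normK (num_real s)) st; field.
  have := ler_wpM2l np0 h; rewrite s2; nra.
have h1 := tail (t / 4) (n%:R * p * (1 + t)) Q1.
have h2 := tail (- (t / 4)) (n%:R * p * (1 - t)) Q2.
rewrite (_ : [set w | _] = [set w | Q1 (hit_pattern w)] `|` [set w | Q2 (hit_pattern w)]).
  apply: (le_trans (measureU2 _ _ _)); try exact: measurable_hit_pattern.
  rewrite mulr_natl mulr2n EFinD leeD//.
    apply: h1.
    - by rewrite ger0_norm// divr_ge0// ltW.
    - by congr (_ * _); field.
    - by move=> J; rewrite /Q1 => h; rewrite mulr_ge0 ?divr_ge0 ?(ltW t0)// subr_ge0 ltW.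
  apply: h2.
  - by rewrite normrN ger0_norm// divr_ge0// ltW.
  - by congr (_ * _); field.
  - move=> J; rewrite /Q2 => h; rewrite mulNr -mulrN mulr_ge0 ?divr_ge0 ?(ltW t0)//.
    by rewrite opprB subr_ge0 ltW.
apply/seteqP; split => w /=; rewrite /Q1 /Q2 lter_normr.
  by move=> /orP[h|h]; [left|right]; lra.
by move=> [h|h]; apply/orP; [left|right]; lra.
Qed.

End chernoff.

(** * Cutting a set into pieces of equal mass *)

Section equal_mass.
Variables (R : realType) (N : nat) (i0 : 'I_N) (M : R).
Variable mu : {finite_measure set 'rV[R]_N -> \bar R}.
Hypothesis M_ge0 : 0 <= M.
Hypothesis muM : forall A, measurable A -> (mu A <= M%:E * lebesgue_rV R N A)%E.

Let below (t : R) : set 'rV[R]_N := [set x | x ord0 i0 < t].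

Let mbelow t : measurable (below t).
Proof.
rewrite (_ : below t = (fun x : 'rV[R]_N => x ord0 i0) @^-1` `]-oo, t[%classic).
  rewrite -[X in measurable X]setTI.
  by apply: measurable_coord => //; exact: measurable_itv.
by apply/seteqP; split=> x; rewrite /below /= in_itv.
Qed.

Let mass B t := fine (mu (B `&` below t)).

Let massD B s t : measurable B -> s <= t ->
  mass B t = mass B s + fine (mu ((B `&` below t) `\` below s)).
Proof.
move=> mB st; rewrite /mass -fineD ?fin_num_measure//; last 2 first.
- exact: measurableI.
- by apply: measurableD => //; exact: measurableI.
rewrite -measureU//=; last 3 first.
- exact: measurableI.
- by apply: measurableD => //; exact: measurableI.
- by apply/seteqP; split => // x [[_ xs] [_ nxs]].
congr (fine (mu _)); apply/seteqP; split => x /=.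
  move=> [Bx xt]; have [xs|xs] := pselect (below s x); [by left|by right].
by move=> [[Bx xs]|[]//]; split => //; rewrite /below/= in xs *; exact: lt_le_trans st.
Qed.

(** The added slab lies in a box with one side [t - s] and the other [N.-1] sides [2 * r]. *)
Let mass_lipschitz B r s t : measurable B -> B `<=` eball 0 r -> 0 < r ->
  s <= t -> 0 <= mass B t - mass B s <= M * (2 * r) ^+ N.-1 * (t - s).
Proof.
move=> mB Br r0 st; rewrite (massD mB st) addrC addKr fine_ge0//=.
set A := _ `\` _; have mA : measurable A.
  by apply: measurableD => //; exact: measurableI.
pose I i : set (measurableTypeR R) :=
  if i == i0 then `[s, t[%classic else `]-r, r[%classic.
have mI i : measurable (I i) by rewrite /I; case: ifP => _; exact: measurable_itv.
have AI : A `<=` [set x | forall i, I i (x ord0 i)].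
  move=> x [[Bx xt] xs] i; rewrite /I; case: eqP => [->|_].
    by rewrite /= in_itv/=; apply/andP; split => //; rewrite leNgt; apply/negP.
  rewrite /= in_itv/= -ltr_norml (le_lt_trans (ler_coord_enorm _ _))//.
  by have := Br _ Bx; rewrite /eball/= subr0.
have : (mu A <= (M * (2 * r) ^+ N.-1 * (t - s))%:E)%E.
  apply: (le_trans (muM mA)).
  rewrite -mulrA EFinM lee_wpmul2l ?lee_fin//.
  apply: (@le_trans _ _ (lebesgue_rV R N [set x | forall i, I i (x ord0 i)])).
    by apply: le_measure; rewrite ?inE//; exact: measurable_box.
  rewrite lebesgue_rV_box// (bigD1 i0)//= muleC EFinM.
  have -> : lebesgue_measure (I i0) = (t - s)%:E.
    rewrite /I eqxx lebesgue_measure_itv/= lte_fin; case: ltP => //.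
    by move=> ts; have -> : t = s by [apply/eqP; rewrite eq_le ts st]; rewrite subrr.
  rewrite lee_wpmul2r ?lee_fin ?subr_ge0//.
  rewrite (eq_bigr (fun=> (2 * r)%:E)); last first.
    move=> i /negPf ii0; rewrite /I ii0 lebesgue_measure_itv/= lte_fin.
    by rewrite ifT; [congr EFin; ring|lra].
  by rewrite prodEFin prodr_const cardC1 card_ord.
by rewrite -[mu A]fineK ?fin_num_measure// lee_fin.
Qed.

(** The intermediate value theorem on [[-r, r]]: the mass below is 0 at the left end and the whole
    mass of [B] at the right end. *)
Lemma cut_mass B r (v : R) : measurable B -> B `<=` eball 0 r -> 0 < r ->
  0 <= v <= fine (mu B) -> exists t, fine (mu (B `&` below t)) = v.
Proof.
move=> mB Br r0 /andP[v0 vB].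
set K := M * (2 * r) ^+ N.-1.
have K0 : 0 <= K by rewrite mulr_ge0// exprn_ge0// mulr_ge0// ltW.
have lip s t : `|mass B s - mass B t| <= K * `|s - t|.
  have [st|/ltW ts] := leP s t.
    have /andP[h1 h2] := mass_lipschitz mB Br r0 st.
    by rewrite distrC ger0_norm// distrC ger0_norm// subr_ge0.
  have /andP[h1 h2] := mass_lipschitz mB Br r0 ts.
  by rewrite ger0_norm// ger0_norm// subr_ge0.
have cont : continuous (mass B).
  move=> s; apply/cvgrPdist_lt => e e0.
  have K1 : 0 < K + 1 by rewrite ltr_wpDl.
  near=> t; rewrite (le_lt_trans (lip s t))//.
  have : `|s - t| < e / (K + 1).
    near: t; apply: (@cvgr_dist_lt _ _ _ (nbhs s) _ id) => //.
    by rewrite divr_gt0.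
  rewrite ltr_pdivlMr// => h; apply: le_lt_trans h.
  by rewrite mulrC ler_wpM2l// lerDl.
have mr : mass B (- r) = 0.
  rewrite /mass (_ : _ `&` _ = set0) ?measure0//.
  apply/seteqP; split => // x [/Br]; rewrite /eball/= subr0 => xr.
  rewrite /below/= => xr'; have := ler_coord_enorm x i0.
  by rewrite ler_norml => /andP[]; lra.
have Mr : mass B r = fine (mu B).
  rewrite /mass; congr (fine (mu _)); apply/setIidPl => x /Br.
  rewrite /eball/= subr0 => xr.
  by rewrite /below/= (le_lt_trans _ xr)// (le_trans (ler_norm _))// ler_coord_enorm.
have [|||t _ tv] := @IVT R (mass B) (- r) r v.
- by rewrite lerNl; lra.
- exact: continuous_subspaceT.
- by rewrite mr Mr ge_min le_max v0 vB orbT.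
by exists t.
Unshelve. all: by end_near. Qed.

(* The pieces are slabs between the hyperplanes x_i0 = t: the mass below such a
   hyperplane is Lipschitz in t, so every intermediate value is attained. *)
Lemma equal_mass_label n (J : {set 'I_n}) B r (v : R) :
  measurable B -> B `<=` eball 0 r -> 0 < r -> 0 <= v ->
  (0 < #|J|)%N -> fine (mu B) = #|J|%:R * v ->
  exists g : 'rV[R]_N -> 'I_n,
    [/\ forall i, measurable (B `&` g @^-1` [set i]),
        forall x, B x -> g x \in J &
        forall i, i \in J -> mu (B `&` g @^-1` [set i]) = v%:E].
Proof.
move=> + + r0 v0.
have [k] := ubnP #|J|; elim: k => // k IH in J B *.
rewrite ltnS leq_eqVlt => /predU1P[Jk|]; last exact: IH.
move=> mB Br /card_gt0P[i iJ] BE.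
have fm A : measurable A -> mu A \is a fin_num by move=> mA; rewrite fin_num_measure.
have JE : #|J| = #|J :\ i|.+1 by rewrite (cardsD1 i) iJ.
have [J0|J0] := posnP #|J :\ i|.
  exists (fun=> i); split => //.
  - by move=> j; rewrite preimage_cst; case: ifP => _; rewrite ?setIT ?setI0.
  - move=> j jJ; have -> : j = i.
      apply: contraTeq jJ => ji; apply/negP => jJ.
      by move/eqP : J0; rewrite cards_eq0 => /eqP/setP/(_ j); rewrite !inE ji jJ.
    rewrite (_ : _ @^-1` _ = setT) ?setIT; last by apply/seteqP; split.
    by rewrite -[LHS]fineK ?fm// BE JE J0 mul1r.
(* A slab of mass [v] is cut off for the label [i]; the remainder has mass [(#|J| - 1) * v] and is
   shared by induction among the other labels. *)
have [|t tv] := @cut_mass B r v mB Br r0.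
  by rewrite v0 BE JE ler_peMl// ler1n.
have mB2 : measurable (B `\` below t) by exact: measurableD.
have [||||g [mg gJ gv]] := IH (J :\ i) (B `\` below t) _ mB2.
- by rewrite -ltnS -JE Jk.
- by move=> x [/Br].
- by [].
- have : fine (mu B) = fine (mu (B `&` below t)) + fine (mu (B `\` below t)).
    rewrite -fineD ?fm//; last exact: measurableI.
    rewrite addeC -measureU//=; last 2 first.
    - exact: measurableI.
    - by apply/seteqP; split => // x [[_ nb] [_ b]].
    congr (fine (mu _)); apply/seteqP; split => x /=; last by case=> -[].
    by move=> Bx; have [xs|xs] := pselect (below t x); [right|left].
  by rewrite tv BE JE -natr1 mulrDl mul1r => h; lra.
pose g' (x : 'rV[R]_N) := if x ord0 i0 < t then i else g x.
have g'i : B `&` g' @^-1` [set i] = B `&` below t.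
  apply/seteqP; split => x [Bx]; rewrite /g' /below /=; case: ifP => //.
  move=> xt gi; have : g x \in J :\ i by apply: gJ; split=> //; rewrite /below/= xt.
  by rewrite gi !inE eqxx.
have g'j j : j != i -> B `&` g' @^-1` [set j] = (B `\` below t) `&` g @^-1` [set j].
  move=> ji; apply/seteqP; split => x; rewrite /g' /below /=.
    by move=> [Bx]; case: ifPn => // xt ij; rewrite ij eqxx in ji.
  by move=> [[Bx /negP/negPf ->]].
exists g'; split.
- move=> j; have [->|ji] := eqVneq j i; first by rewrite g'i; exact: measurableI.
  by rewrite g'j.
- move=> x Bx; rewrite /g'; case: ifPn => // xt.
  have : g x \in J :\ i by apply: gJ; split=> //; exact/negP.
  by rewrite !inE => /andP[].
- move=> j jJ; have [->|ji] := eqVneq j i.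
    by rewrite g'i -tv fineK// fm//; exact: measurableI.
  by rewrite g'j// gv// !inE ji.
Qed.

End equal_mass.

(** * Uniform bounds and null points *)

Section linfty.
Variables (R : realType) (N : nat) (Omega : set 'rV[R]_N).

Lemma Linfty_norm_le (f : 'rV[R]_N -> R) (M : R) : 0 <= M ->
  (forall x, Omega x -> `|f x| <= M) -> (Linfty_norm Omega f <= M%:E)%E.
Proof.
move=> M0 fM; rewrite /Linfty_norm unlock; case: ifP => _; last by rewrite lee_fin.
apply/ess_supP/aeW => x /=; rewrite patchE; case: ifPn.
  by rewrite inE lee_fin; exact: fM.
by rewrite normr0 lee_fin.
Qed.

End linfty.

Lemma measurable_set1_rV (R : realType) N (z : 'rV[R]_N) : measurable [set z].
Proof.
rewrite (_ : [set z] = [set x | forall i, [set z ord0 i] (x ord0 i)]).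
  by apply: (@measurable_box _ _ (fun i => [set z ord0 i])) => i; exact: measurable_set1.
by apply/seteqP; split => [x -> //|x xz]; apply/rowP.
Qed.

Lemma lebesgue_rV_set1 (R : realType) N (i0 : 'I_N) (z : 'rV[R]_N) :
  lebesgue_rV R N [set z] = 0%E.
Proof.
rewrite (_ : [set z] = [set x | forall i, [set z ord0 i] (x ord0 i)]).
  rewrite (@lebesgue_rV_box _ _ (fun i => [set z ord0 i])); last first.
    by move=> i; exact: measurable_set1.
  by rewrite (bigD1 i0)//= lebesgue_measure_set1 mul0e.
by apply/seteqP; split => [x -> //|x xz]; apply/rowP.
Qed.

(** * Construction of the transport partition from accurate cell counts *)

Section transport_exists.
Variables (R : realType) (N : nat) (i0 : 'I_N) (phi0 phi1 L : R).
Variables (Omega : set 'rV[R]_N) (mu : probability 'rV[R]_N R).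
Variable phi : 'rV[R]_N -> R.
Hypotheses (phi0_gt0 : 0 < phi0) (phi01 : phi0 <= phi1) (L_ge0 : 0 <= L).
Hypotheses (oO : open Omega) (bO : exists r, Omega `<=` eball 0 r).
Hypothesis density : has_lipschitz_density Omega phi0 phi1 L mu phi.
Variables (n m : nat) (Z : 'I_n -> 'rV[R]_N) (B : 'I_m -> set 'rV[R]_N).
Variables (eps : R).
Hypotheses (n_gt0 : (0 < n)%N) (eps_gt0 : 0 < eps) (eps_lt1 : eps < 1).
Hypothesis Zinj : injective Z.
Hypothesis ZO : forall i, Omega (Z i).
Hypothesis partB : is_partition Omega B.
Hypothesis diamB : forall l x y, B l x -> B l y -> enorm (x - y) < eps ^+ 3.

Local Notation p l := (fine (mu (B l))).
Let J l : {set 'I_n} := [set i | `[< B l (Z i) >]].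

Hypothesis countB : forall l,
  `|#|J l|%:R - n%:R * p l| <= p l * eps ^+ 2 * n%:R.

Let mB l : measurable (B l). Proof. by have [] := partB. Qed.
Let phi1_ge0 : 0 <= phi1. Proof. by rewrite (le_trans _ phi01)// ltW. Qed.
Let n0 : 0 < n%:R :> R. Proof. by rewrite ltr0n. Qed.
Let BO l : B l `<=` Omega.
Proof. by have [_ _ _ <-] := partB; exact: bigcup_sup. Qed.

Let fm A : measurable A -> mu A \is a fin_num.
Proof. by move=> mA; rewrite fin_num_measure. Qed.

Let muM A : measurable A -> (mu A <= phi1%:E * lebesgue_rV R N A)%E.
Proof. by move=> mA; apply: (density_measure_le phi0_gt0 L_ge0 oO density). Qed.

Lemma cell_mass_gt0 l : 0 < p l.
Proof.
have [_ B0 _ _] := partB; rewrite fine_gt0// ltey_eq fm// andbT.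
apply: lt_le_trans (density_measure_ge phi0_gt0 L_ge0 oO density (mB l) (@BO l)).
by rewrite mule_gt0// B0.
Qed.

Let eps2 : eps ^+ 2 < 1. Proof. by rewrite expr_lt1// ltW. Qed.

(** A relative error below 1 leaves no cell without sample points. *)
Let J_gt0 l : (0 < #|J l|)%N.
Proof.
rewrite -(ltr0n R); have := countB l; rewrite ler_distl => /andP[h _].
apply: lt_le_trans h; rewrite subr_gt0 mulrAC -[ltRHS]mulr1 [n%:R * _]mulrC.
by rewrite ltr_pM2l// mulr_gt0// cell_mass_gt0.
Qed.

Let v l := p l / #|J l|%:R.
Let v_gt0 l : 0 < v l.
Proof. by rewrite divr_gt0 ?cell_mass_gt0// ltr0n. Qed.

Lemma transport_partition_exists :
  exists U phi_eps, transport_partition Z Omega phi phi1 eps U phi_eps.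
Proof.
have [r Or] := bO.
have r1 : 0 < Num.max r 1 by rewrite lt_max ltr01 orbT.
have Or1 : Omega `<=` eball 0 (Num.max r 1).
  by move=> x /Or; rewrite /eball/= => xr; rewrite lt_max xr.
have /choice[g gP] : forall l, exists g : 'rV[R]_N -> 'I_n,
    [/\ forall i, measurable (B l `&` g @^-1` [set i]),
        forall x, B l x -> g x \in J l &
        forall i, i \in J l -> mu (B l `&` g @^-1` [set i]) = (v l)%:E].
  move=> l; apply: (@equal_mass_label R N i0 phi1 mu phi1_ge0 muM n (J l) (B l)
    (Num.max r 1)) => //.
  - by move=> x /BO/Or1.
  - exact: ltW.
  - by rewrite /v mulrCA divff ?mulr1// pnatr_eq0 -lt0n.
have /choice[cl clP] : forall x, exists l, Omega x -> B l x.
  move=> x; have [Ox|nOx] := pselect (Omega x).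
    by have [_ _ _ UB] := partB; move: (Ox); rewrite -UB => -[l _ Blx]; exists l.
  (* Outside [Omega] any cell serves as default; one exists since [Omega] contains a sample
     point. *)
  have [_ _ _ UB] := partB.
  have [l _ _] : (\bigcup_l B l) (Z (Ordinal n_gt0)) by rewrite UB.
  by exists l.
have cl_uniq x l : B l x -> cl x = l.
  move=> Blx; have [_ _ tB _] := partB; apply: tB => //.
  by exists x; split => //; apply: clP; exact: BO Blx.
(* The slabs given by [g] need not contain their own sample point. [G] therefore relabels the sample
   points, a null set. *)
pose G x := if pselect (exists j, x = Z j) is left h then projT1 (cid h) else g (cl x) x.
have GZ i : G (Z i) = i.
  rewrite /G; case: pselect => [h|]; last by case; exists i.
  by case: cid => j /= /Zinj.
pose S := \bigcup_(j : 'I_n) [set Z j].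
have GS x : ~ S x -> G x = g (cl x) x.
  move=> Sx; rewrite /G; case: pselect => // -[j xj]; exfalso; apply: Sx.
  by exists j.
have mS : measurable S.
  by apply: measurable_bigcup_ord => i; exact: measurable_set1_rV.
have mu1 z : mu [set z] = 0%E.
  apply/eqP; rewrite eq_le measure_ge0 andbT.
  rewrite (le_trans (muM (measurable_set1_rV z)))// (lebesgue_rV_set1 i0).
  by rewrite mule0.
have muS : mu S = 0%E.
  apply/eqP; rewrite eq_le measure_ge0 andbT.
  rewrite (le_trans (measure_bigcup_ord_le mu _))// => [i|].
    exact: measurable_set1_rV.
  by rewrite big1// => i _; exact: mu1.
pose U i := Omega `&` G @^-1` [set i].
pose W i := B (cl (Z i)) `&` g (cl (Z i)) @^-1` [set i].
have mW i : measurable (W i) by have [h _ _] := gP (cl (Z i)); exact: h.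
have iJ i : i \in J (cl (Z i)).
  by rewrite inE; apply/asboolP/clP.
have muW i : mu (W i) = (v (cl (Z i)))%:E by have [_ _ h] := gP (cl (Z i)); exact: h.
have UE i : U i = (W i `\` S) `|` [set Z i].
  apply/seteqP; split => x; last first.
    move=> [[[Bx gx] Sx]|->]; last by split; [exact: ZO|exact: GZ].
    split; first exact: BO Bx.
    by rewrite /preimage/= GS// (cl_uniq _ _ Bx).
  move=> [Ox Gx]; have [[j _ xj]|Sx] := pselect (S x).
    by right; move: Gx; rewrite /preimage/= xj GZ => ->.
  left; split => //; move: Gx; rewrite /preimage/= GS// => gx.
  have [_ /(_ x (clP x Ox)) + _] := gP (cl x).
  rewrite gx inE => /asboolP/cl_uniq ci.
  by split; rewrite /preimage/= ci//; exact: clP.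
have mU i : measurable (U i).
  rewrite UE; apply: measurableU; last exact: measurable_set1_rV.
  exact: measurableD.
have UB i : U i `<=` B (cl (Z i)).
  by move=> x; rewrite UE => -[[[]//]|->]; exact: clP.
have muU0 A C : measurable A -> measurable C -> mu C = 0%E ->
    (mu (A `|` C) <= mu A)%E.
  move=> mA mC C0; apply: (le_trans (measureU2 mu mA mC)).
  by rewrite -[leRHS]adde0 -C0; apply: leeD.
have muU i : mu (U i) = (v (cl (Z i)))%:E.
  rewrite -muW; apply/eqP; rewrite eq_le; apply/andP; split.
    rewrite UE; apply: (@le_trans _ _ (mu (W i `\` S))).
      apply: muU0 (mu1 _); [exact: measurableD|exact: measurable_set1_rV].
    apply: le_measure; rewrite ?inE; [exact: measurableD|exact: mW|].
    by move=> x [].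
  apply: (@le_trans _ _ (mu (U i `|` S))).
    apply: le_measure; rewrite ?inE//; first exact: measurableU.
    by move=> x Wx; have [Sx|Sx] := pselect (S x); [right|left; rewrite UE; left].
  exact: muU0.
have tU : trivIset setT U.
  by move=> i j _ _ [x [[_ <-] [_ <-]]].
have UO : \bigcup_i U i = Omega.
  apply/seteqP; split => [x [i _ []//]|x Ox].
  by exists (G x).
have muE A : measurable A -> mu A = (\int[lebesgue_rV R N]_(x in A) (phi x)%:E)%E.
  by have [_ _ _] := density; exact.
(* The factor that makes the integral over [U i] equal to [1/n]. It is the quotient of the actual
   and the expected number of points in the cell, hence within [eps ^+ 2] of 1 by [countB]. *)
pose c i := (n%:R * v (cl (Z i)))^-1.
have c_ge0 i : 0 <= c i by rewrite invr_ge0 ltW// mulr_gt0.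
pose phi_eps x := \sum_(i < n) c i * phi x * \1_(U i) x.
have phi_epsE i x : U i x -> phi_eps x = c i * phi x.
  move=> Ux; rewrite /phi_eps (bigD1 i)//= indicE mem_set// mulr1.
  rewrite big1 ?addr0// => k ki; rewrite indicE memNset ?mulr0// => Uk.
  by move: ki; rewrite (tU k i I I) ?eqxx//; exists x.
have mphi : measurable_fun setT phi by exact: measurable_density L_ge0 oO density.
have phi_ge0 x : 0 <= phi x by exact: density_ge0 phi0_gt0 density x.
have mphie : measurable_fun setT phi_eps.
  apply: measurable_sum => i; apply: measurable_funM; first exact: measurable_funM.
  exact: measurable_indic.
have phie_ge0 x : 0 <= phi_eps x.
  by apply: sumr_ge0 => i _; rewrite !mulr_ge0.
have intU i : (\int[lebesgue_rV R N]_(x in U i) (phi_eps x)%:E = (n%:R^-1)%:E)%E.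
  rewrite (eq_integral (fun x => (c i)%:E * (phi x)%:E)%E); last first.
    by move=> x; rewrite inE => /phi_epsE ->.
  rewrite ge0_integralZl_EFin//; last 2 first.
  - by move=> x _; rewrite lee_fin.
  - by apply/measurable_EFinP; exact: measurable_funTS.
  rewrite -muE// muU -EFinM /c; congr EFin; field.
  by rewrite !gt_eqF.
have cB i : `|c i - 1| <= eps ^+ 2.
  have vE : c i = #|J (cl (Z i))|%:R / (n%:R * p (cl (Z i))).
    have Jn0 : #|J (cl (Z i))|%:R != 0 :> R by rewrite pnatr_eq0 -lt0n.
    have pn0 : p (cl (Z i)) != 0 by rewrite gt_eqF// cell_mass_gt0.
    have nn0 : n%:R != 0 :> R by rewrite gt_eqF.
    by rewrite /c /v; field; rewrite ?Jn0 ?pn0 ?nn0.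
  have p0 := cell_mass_gt0 (cl (Z i)).
  have np0 : 0 < n%:R * p (cl (Z i)) by rewrite mulr_gt0.
  rewrite vE -[X in _ - X](@divff _ (n%:R * p (cl (Z i)))) ?gt_eqF//.
  rewrite -mulrBl normrM normfV (gtr0_norm np0) ler_pdivrMr//.
  by rewrite (le_trans (countB _))// mulrAC mulrC [_ * n%:R]mulrC.
have phi_le x : phi x <= phi1 by exact: density_le density x phi1_ge0.
have phieB x : Omega x -> `|phi_eps x - phi x| <= phi1 * eps ^+ 2.
  rewrite -UO => -[i _ Ux]; rewrite (phi_epsE _ _ Ux).
  rewrite -{2}[phi x]mul1r -mulrBl normrM mulrC ler_pM//.
  by rewrite ger0_norm.
exists U, phi_eps; split.
- split => // i; rewrite lt_def measure_ge0 andbT.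
  (* A set of positive mass cannot have zero volume, because the density is bounded. *)
  apply/eqP => U0; have := muM (mU i); rewrite U0 mule0 muU lee_fin.
  by rewrite leNgt v_gt0.
- move=> i; split; first by split; [exact: ZO|exact: GZ].
  by move=> x /UB Bx; apply: diamB Bx _; exact: clP.
- split => //.
  + exact: measurable_funTS.
  + apply: (@le_lt_trans _ _ (2 * phi1)%:E); last exact: ltry.
    apply: Linfty_norm_le; first by rewrite mulr_ge0.
    move=> x /phieB h; have : phi1 * eps ^+ 2 <= phi1 by rewrite ler_piMr// ltW.
    have := phi_ge0 x; have := phi_le x; rewrite ger0_norm//.
    by move: h; rewrite ler_distl => /andP[]; lra.
  + rewrite -UO bigcup_ord ge0_integral_bigsetU//=.
    * under eq_bigr do rewrite intU.
      rewrite sumEFin sumr_const card_ord -[_ *+ n]mulr_natr mulVf//.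
      by rewrite gt_eqF.
    * exact: index_enum_uniq.
    * exact: sub_trivIset tU.
    * by apply/measurable_EFinP; exact: measurable_funTS.
    * by move=> x _; rewrite lee_fin.
- exact: intU.
- by apply: Linfty_norm_le => //; rewrite mulr_ge0// sqr_ge0.
Qed.

End transport_exists.

(** * Events of the i.i.d. sample *)

Section sample.
Variables (R : realType) (N : nat) (d : measure_display).
Variables (S : measurableType d) (P : probability S R).
Variables (mu : probability 'rV[R]_N R) (n : nat).
Variable Z : 'I_n -> S -> 'rV[R]_N.
Hypothesis iidZ : iid_sample P mu Z.

Lemma measurable_sample i A : measurable A -> measurable (Z i @^-1` A).
Proof.
by move=> mA; have [mZ _ _] := iidZ; rewrite -[X in measurable X]setTI; exact: mZ.
Qed.

(** The product rule concerns all [n] points at once, so the remaining ones are constrained to the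
    whole space. *)
Lemma sample_pair i j A : i != j -> measurable A ->
  P (Z i @^-1` A `&` Z j @^-1` A) = (mu A * mu A)%E.
Proof.
move=> ij mA; have [mZ PZ indZ] := iidZ.
pose B k := if (k == i) || (k == j) then A else setT.
have mB k : measurable (B k) by rewrite /B; case: ifP.
rewrite (_ : _ `&` _ = \bigcap_k (Z k @^-1` B k)); last first.
  apply/seteqP; split => w /=.
    by move=> [wi wj] k _; rewrite /B/=; case: ifP => // /orP[/eqP->|/eqP->].
  by move=> h; have := h i I; have := h j I; rewrite /B /= !eqxx orbT.
rewrite indZ// (bigD1 i)//= (bigD1 j)/=; last by rewrite eq_sym.
rewrite big1 ?mule1 ?PZ /B ?eqxx ?orbT// => k /andP[/negPf ki /negPf kj].
by rewrite ki kj preimage_setT probability_setT.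
Qed.

(** The form in which the Chernoff bound takes independence: the product rule with [A] or its
    complement for each index. *)
Lemma sample_pattern A (J : {set 'I_n}) : measurable A ->
  P (\bigcap_i (if i \in J then Z i @^-1` A else ~` (Z i @^-1` A))) =
  (\prod_(i < n) (if i \in J then fine (mu A) else 1 - fine (mu A)))%:E.
Proof.
move=> mA; have [mZ PZ indZ] := iidZ.
pose B i := if i \in J then A else ~` A.
have mB i : measurable (B i) by rewrite /B; case: ifP => // _; exact: measurableC.
rewrite (_ : \bigcap_i _ = \bigcap_i (Z i @^-1` B i)); last first.
  by apply: eq_bigcapr => i _; rewrite /B; case: ifP.
have muA : mu A \is a fin_num by rewrite fin_num_measure.
rewrite indZ// -prodEFin; apply: eq_bigr => i _; rewrite PZ// /B; case: ifP => _.
  by rewrite fineK.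
by rewrite probability_setC// EFinB fineK.
Qed.

Lemma measurable_tie i j : measurable [set w | Z i w = Z j w].
Proof.
have [mZ _ _] := iidZ.
have mZk i' k : measurable_fun setT (fun w => Z i' w ord0 k).
  exact: (measurableT_comp (measurable_coord k) (mZ i')).
rewrite (_ : [set w | _] = \bigcap_(k : 'I_N)
    (fun w => Z i w ord0 k - Z j w ord0 k) @^-1` [set 0]).
  apply: fin_bigcap_measurable => // k _; rewrite -[X in measurable X]setTI.
  by apply: measurable_funB => //; exact: measurable_set1.
apply/seteqP; split => w /=; first by move=> Zij k _ /=; rewrite Zij subrr.
by move=> h; apply/rowP => k; apply/eqP; rewrite -subr_eq0; apply/eqP/h.
Qed.

End sample.

(** * The probability estimate *)

Section good_event.
Variables (R : realType) (N : nat) (phi0 phi1 L c : R).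
Variables (Omega : set 'rV[R]_N) (mu : probability 'rV[R]_N R).
Variable phi : 'rV[R]_N -> R.
Hypotheses (N_gt0 : (0 < N)%N).
Hypotheses (phi0_gt0 : 0 < phi0) (phi01 : phi0 <= phi1) (L_ge0 : 0 <= L).
Hypotheses (oO : open Omega) (bO : exists r, Omega `<=` eball 0 r).
Hypothesis density : has_lipschitz_density Omega phi0 phi1 L mu phi.
Hypotheses (c_gt0 : 0 < c) (partO : partition_condition Omega c).
Variables (d : measure_display) (S : measurableType d) (P : probability S R).
Variables (n : nat) (Z : 'I_n -> S -> 'rV[R]_N).
Hypotheses (n_gt0 : (0 < n)%N) (iidZ : iid_sample P mu Z).
Hypothesis ZO : forall i w, Omega (Z i w).

Let phi1_ge0 : 0 <= phi1. Proof. by rewrite (le_trans _ phi01)// ltW. Qed.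

Let fm A : measurable A -> mu A \is a fin_num.
Proof. by move=> mA; rewrite fin_num_measure. Qed.

Lemma sum_cell_mass m (B : 'I_m -> set 'rV[R]_N) : is_partition Omega B ->
  \sum_(l < m) fine (mu (B l)) <= 1.
Proof.
move=> [mB _ tB UB]; rewrite -lee_fin -sumEFin.
rewrite (eq_bigr (fun l => mu (B l))); last by move=> l _; rewrite fineK// fm.
rewrite -measure_bigcup_ord//; apply: probability_le1.
exact: measurable_bigcup_ord.
Qed.

(* Two equal points lie in a common cell, which has probability at most the
   largest cell mass; this tends to 0 with the diameter of the cells. *)
Lemma tie_null i j : i != j -> P [set w | Z i w = Z j w] = 0%E.
Proof.
move=> ij; have mT := measurable_tie iidZ i j.
have Pf A : measurable A -> P A \is a fin_num by move=> mA; rewrite fin_num_measure.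
pose K := phi1 * 2 ^+ N; have K_ge0 : 0 <= K by rewrite mulr_ge0.
have small delta : 0 < delta < 1 -> fine (P [set w | Z i w = Z j w]) <= K * delta.
  move=> /andP[d0 d1]; have [|m [B [x [pB hB]]]] := partO (delta := delta).
    by rewrite d0.
  have [mB _ tB UB] := pB.
  have BK l : fine (mu (B l)) <= K * delta.
    have [_ Bx _] := hB l.
    rewrite -lee_fin fineK ?fm//.
    apply: (le_trans (density_measure_le phi0_gt0 L_ge0 oO density phi1_ge0 (mB l))).
    rewrite -mulrA EFinM lee_wpmul2l ?lee_fin//.
    apply: (@le_trans _ _ (lebesgue_rV R N (eball (x l) delta))).
      by apply: le_measure; rewrite ?inE//; exact: measurable_eball.
    apply: (le_trans (lebesgue_rV_eball_le _ (ltW d0))).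
    rewrite lee_fin exprMn ler_wpM2l// -[leRHS]expr1.
    by rewrite ler_wiXn2l// ltW.
  rewrite -lee_fin fineK ?Pf//.
  have sub : [set w | Z i w = Z j w] `<=`
      \bigcup_l (Z i @^-1` B l `&` Z j @^-1` B l).
    move=> w /= Zij; have : (\bigcup_l B l) (Z i w) by rewrite UB.
    by move=> [l _ Bl]; exists l => //; split => //; rewrite /preimage/= -Zij.
  have mp l : measurable (Z i @^-1` B l `&` Z j @^-1` B l).
    by apply: measurableI; exact: (measurable_sample iidZ).
  apply: (@le_trans _ _ (P (\bigcup_l (Z i @^-1` B l `&` Z j @^-1` B l)))).
    by apply: le_measure; rewrite ?inE//; exact: measurable_bigcup_ord.
  apply: (le_trans (measure_bigcup_ord_le P mp)).
  rewrite (eq_bigr (fun l => (fine (mu (B l)) * fine (mu (B l)))%:E)); last first.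
    move=> l _; rewrite EFinM fineK ?fm//.
    exact: (sample_pair iidZ ij).
  rewrite sumEFin lee_fin.
  (* In each squared mass one factor is bounded by [K * delta]; the other factors add up to at most
     1. *)
  apply: (@le_trans _ _ (\sum_(l < m) K * delta * fine (mu (B l)))).
    by apply: ler_sum => l _; rewrite ler_wpM2r ?fine_ge0.
  rewrite -mulr_sumr ler_piMr//; first by rewrite mulr_ge0// ltW.
  exact: sum_cell_mass.
rewrite -[LHS]fineK ?Pf//; congr EFin; apply/eqP; rewrite eq_le fine_ge0// andbT.
rewrite leNgt; apply/negP; set q := fine _ => q0.
have K1 : 0 < K + 1 by rewrite ltr_wpDl.
(* Makes [K * delta] smaller than [q], contradicting [small]; the bound [2^-1] keeps [delta] in the
   range of the partition condition. *)
pose delta := Num.min 2^-1 (q / (2 * (K + 1))).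
have d0 : 0 < delta by rewrite lt_min invr_gt0 ltr0n/= divr_gt0// mulr_gt0.
have d1 : delta < 1 by rewrite gt_min; apply/orP; left; lra.
have dq : delta * (2 * (K + 1)) <= q.
  by rewrite -ler_pdivlMr ?mulr_gt0// ge_min lexx orbT.
have := small delta; rewrite d0 d1 => /(_ isT); rewrite -/q.
by nra.
Qed.

(** The complement of finitely many bad events: a count off by more than the relative error
    [eps ^+ 2] in some cell, or two coinciding points. The former cost [2 * E] per cell, the latter
    nothing. *)
Lemma good_event (eps : R) : 0 < eps < 2^-1 ->
  exists A : set S,
    [/\ measurable A,
        A `<=` [set w | exists U phi_eps,
          transport_partition (Z ^~ w) Omega phi phi1 eps U phi_eps] &
        ((1 - 2 * n%:R *
           expR (- (phi0 * c / 2 ^+ N / 8 * n%:R * eps ^+ (3 * N + 4))))%:E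
           <= P A)%E].
Proof.
move=> /andP[e0 e1]; set kappa := phi0 * c / 2 ^+ N.
have kappa0 : 0 < kappa by rewrite divr_gt0 ?mulr_gt0// exprn_gt0.
have e3 : 0 < eps ^+ 3 by rewrite exprn_gt0.
have e31 : eps ^+ 3 < 1 by rewrite expr_lt1 ?ltW//; lra.
(* Radius [eps ^+ 3 / 2] gives cells of diameter below [eps ^+ 3]; the factor [2 ^+ N] in [kappa]
   comes from this halving. *)
have [|m [B [x [pB hB]]]] := partO (delta := eps ^+ 3 / 2).
  by apply/andP; split; lra.
have [mB _ tB UB] := pB.
pose p l := fine (mu (B l)).
have BO l : B l `<=` Omega by rewrite -UB; exact: bigcup_sup.
have p_ge l : kappa * eps ^+ (3 * N) <= p l.
  have [_ _ Bc] := hB l; rewrite -lee_fin /p fineK ?fm//.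
  apply: le_trans (density_measure_ge phi0_gt0 L_ge0 oO density (mB l) (@BO l)).
  rewrite (_ : kappa * _ = phi0 * (c * (eps ^+ 3 / 2) ^+ N)).
    by rewrite EFinM lee_wpmul2l// lee_fin ltW.
  by rewrite expr_div_n exprM /kappa; field; rewrite expf_neq0.
have p01 l : 0 <= p l <= 1.
  by rewrite fine_ge0//= -lee_fin fineK ?fm// probability_le1.
have mk : m%:R * (kappa * eps ^+ (3 * N)) <= 1.
  rewrite (le_trans _ (sum_cell_mass pB))//.
  by rewrite -[m in m%:R]card_ord mulr_natl -sumr_const ler_sum// => l _; exact: p_ge.
have e4 : eps ^+ 4 <= 1 by rewrite exprn_ile1 ?ltW//; lra.
have c0E : kappa / 8 * n%:R * eps ^+ (3 * N + 4) =
    n%:R * (kappa * eps ^+ (3 * N)) * eps ^+ 4 / 8 by rewrite exprD; field.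
rewrite c0E.
have ke0 : 0 < kappa * eps ^+ (3 * N) by rewrite mulr_gt0// exprn_gt0.
(* With more cells than points, [mk] makes the exponent [y] at most [1/2], so
   [2 * n * expR (- y) >= n >= 1]: the bound is not positive and the empty event suffices. *)
have [nm|mn] := ltnP n m.
  exists set0; split => //; rewrite measure0 lee_fin subr_le0.
  set y := _ / 8; have y1 : y <= 2^-1.
    have : n%:R * (kappa * eps ^+ (3 * N)) <= 1.
      by apply: le_trans mk; rewrite ler_wpM2r ?(ltW ke0)// ler_nat ltnW.
    have : 0 <= n%:R * (kappa * eps ^+ (3 * N)) by rewrite mulr_ge0// ltW.
    have : 0 <= eps ^+ 4 by rewrite exprn_ge0// ltW.
    by rewrite /y; move: e4; nra.
  have := expR_ge1Dx (- y).
  have : 1 <= n%:R :> R by rewrite ler1n.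
  by have := expR_gt0 (- y); nra.
pose E := expR (- (n%:R * (kappa * eps ^+ (3 * N)) * eps ^+ 4 / 8)).
pose count l := hit_pattern (fun i => Z i @^-1` B l).
pose bad l : set S :=
  [set w | p l * eps ^+ 2 * n%:R < `|#|count l w|%:R - n%:R * p l|].
pose ties : set S := \bigcup_(i : 'I_n) \bigcup_(j : 'I_n)
  (if i == j then set0 else [set w | Z i w = Z j w]).
have mX l i : measurable (Z i @^-1` B l) by exact: (measurable_sample iidZ i (mB l)).
have mbad l : measurable (bad l).
  exact: (measurable_hit_pattern (mX l)
    (fun J => p l * eps ^+ 2 * n%:R < `|#|J|%:R - n%:R * p l|)).
have Pbad l : (P (bad l) <= (2 * E)%:E)%E.
  (* Chernoff with [t = eps ^+ 2], whose square is the [eps ^+ 4] of the exponent; the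
     [eps ^+ (3 * N)] is the lower bound for the cell mass. *)
  have e2 : 0 < eps ^+ 2 <= 1 by rewrite exprn_gt0//= exprn_ile1 ?ltW//; lra.
  apply: (le_trans (@chernoff_relative _ _ _ P n _ (p l) (mX l) (p01 l)
    (fun J => sample_pattern iidZ J (mB l)) _ e2)).
  rewrite lee_fin ler_wpM2l// ler_expR lerN2 -exprM ler_pM2r//.
  by rewrite ler_wpM2r ?exprn_ge0 ?(ltW e0)// ler_wpM2l.
have mtij i j : measurable (if i == j then set0 else [set w | Z i w = Z j w]).
  by case: ifP => // _; exact: (measurable_tie iidZ).
have mti i : measurable (\bigcup_(j : 'I_n)
    (if i == j then set0 else [set w | Z i w = Z j w])).
  exact: measurable_bigcup_ord.
have mties : measurable ties by exact: measurable_bigcup_ord.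
have Pties : P ties = 0%E.
  apply/eqP; rewrite eq_le measure_ge0 andbT.
  apply: (le_trans (measure_bigcup_ord_le P mti)).
  rewrite big1// => i _; apply/eqP; rewrite eq_le measure_ge0 andbT.
  apply: (le_trans (measure_bigcup_ord_le P (mtij i))).
  rewrite big1// => j _; case: ifPn => [_|ij]; first exact: measure0.
  exact: tie_null.
have mub : measurable (\bigcup_l bad l) by exact: measurable_bigcup_ord.
have mall : measurable (\bigcup_l bad l `|` ties) by exact: measurableU.
exists (~` (\bigcup_l bad l `|` ties)); split.
- exact: measurableC.
- move=> w; rewrite /= => /not_orP[nb nt].
  apply: (@transport_partition_exists R N (Ordinal N_gt0) phi0 phi1 L Omega mu phi
    phi0_gt0 phi01 L_ge0 oO bO density n m (Z ^~ w) B) => //.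
  + by lra.
  + move=> i j /= Zij; apply/eqP; apply: contrapT => /negP ij; apply: nt.
    by exists i => //; exists j => //; rewrite (negPf ij).
  + move=> l y z By Bz; have [_ Bx _] := hB l.
    have := Bx _ By; have := Bx _ Bz; rewrite /eball/= => zx yx.
    rewrite (le_lt_trans (ler_enorm_dist _ (x l) _))// (enormB (x l)).
    by rewrite [ltRHS]splitr ltrD.
  + move=> l; rewrite leNgt; apply/negP => h; apply: nb.
    by exists l.
- rewrite probability_setC//.
  have Pall : (P (\bigcup_l bad l `|` ties) <= (2 * n%:R * E)%:E)%E.
    apply: (le_trans (measureU2 P mub mties)).
    rewrite -[leRHS]adde0; apply: leeD; last by rewrite -Pties.
    apply: (le_trans (measure_bigcup_ord_le P mbad)).
    apply: (@le_trans _ _ (\sum_(l < m) (2 * E)%:E)).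
      by apply: lee_sum => l _; exact: Pbad.
    (* Here [m <= n] replaces the number of cells by the number of points. *)
    rewrite sumEFin lee_fin sumr_const card_ord -[_ *+ m]mulr_natl mulrCA mulrA.
    by rewrite ler_wpM2r ?expR_ge0// ler_wpM2l// ler_nat.
  rewrite EFinB leeB//.
Qed.

End good_event.

(** * Choice of the constants and conclusion *)

Theorem theorem4p3 (R : realType) (N : nat)
    (beta Lambda tau phi0 phi1 L : R) :
  (0 < N)%N -> 0 < beta <= 1 -> 1 <= Lambda -> 1 <= tau ->
  0 < phi0 -> phi0 <= phi1 -> 0 <= L ->
  exists eps1 C0 C : R, [/\ 0 < eps1 < 2^-1, 0 < C0, 0 < C &
  forall D c : R, 0 < c ->
  exists c0 : R, 0 < c0 /\
  forall (Omega : set 'rV[R]_N) (mu : probability 'rV[R]_N R)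
    (phi : 'rV[R]_N -> R),
  bounded_domain Omega -> ediam Omega = D ->
  has_lipschitz_density Omega phi0 phi1 L mu phi ->
  partition_condition Omega c ->
  forall eps0 : R, 0 < eps0 <= eps1 -> inner_domain Omega eps0 !=set0 ->
  forall eps : R, 0 < eps < eps0 ->
  forall n : nat, (0 < n)%N ->
  forall (d : measure_display) (S : measurableType d) (P : probability S R)
    (Z : 'I_n -> S -> 'rV[R]_N),
  iid_sample P mu Z -> (forall i w, Omega (Z i w)) ->
  (exists A : set S,
    [/\ measurable A,
        A `<=` [set w | exists U phi_eps,
          transport_partition (Z ^~ w) Omega phi C0 eps U phi_eps] &
        ((1 - 2 * n%:R * expR (- (c0 * n%:R * eps ^+ (3 * N + 4))))%:E
           <= P A)%E]) /\
  (forall w U phi_eps T,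
    transport_partition (Z ^~ w) Omega phi C0 eps U phi_eps ->
    transport_map (Z ^~ w) Omega U T ->
    forall x, inner_domain Omega eps x ->
    forall u : 'rV[R]_N -> R,
      L_cloud (Z ^~ w) beta Lambda tau eps u (T x) <=
      L_domain Omega mu beta (Lambda + eps ^+ 2) (tau + 2 * eps) eps (u \o T) x
      + C * cloud_norm (Z ^~ w) u)].
Proof.
move=> N_gt0 beta01 L1 t1 phi0_gt0 phi01 L_ge0.
have phi1_gt0 : 0 < phi1 by exact: lt_le_trans phi01.
(* [C0 = phi1], because [phi_eps] is [phi] up to a relative error [eps ^+ 2]; [C] is the constant of
   [transport_operator] for this [C0]. *)
exists 4^-1, phi1, (2 ^+ N.+1 * (phi1 + 4 * N%:R * phi1) / phi0); split => //.
- by apply/andP; split; lra.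
- rewrite divr_gt0// mulr_gt0 ?exprn_gt0// ltr_wpDr// mulr_ge0 ?(ltW phi1_gt0)//.
(* The lower bound [kappa] for the cell masses in units of [eps ^+ (3 * N)], times the [1/8] of the
   Chernoff bound. *)
move=> D c c_gt0; exists (phi0 * c / 2 ^+ N / 8); split.
  by rewrite divr_gt0// divr_gt0 ?exprn_gt0// mulr_gt0.
move=> Omega mu phi [oO _ _ bO] _ density partO eps0 /andP[_ eps01] _.
move=> eps /andP[eps_gt0 eps_lt] n n_gt0 d S P Z iidZ ZO; split.
  apply: (@good_event R N phi0 phi1 L c Omega mu phi) => //.
  by apply/andP; split; lra.
move=> w U phi_eps T tP hT x hx u.
apply: (@transport_operator R N phi0 phi1 L Omega mu phi phi0_gt0 phi01 L_ge0
  oO bO density n (Z ^~ w) phi1 eps U phi_eps) => //.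
- by lra.
- exact: ltW.
Qed.
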